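(* Let $R$ be a commutative ring, let $\mathcal{D}=\mathcal{D}(R)$ be the derived category of $R$-modules, and let $I$ be a finitely generated ideal of $R=\pi_*S$. Then $\mathcal{GH}_{\mathbf{thick}\langle S/I\rangle}$ is true if and only if $I$ is a ring summand of $R$ and $R/I$ is von Neumann regular.
   Context: In $\mathcal{D}(R)$, $S$ is the complex with $R$ in degree zero and $0$ elsewhere, $\wedge$ is the derived tensor product over $R$, and $\pi_iX=\operatorname{Hom}_{\mathcal{D}(R)}(\Sigma^iS,X)$, $\pi_*X=\bigoplus_i\pi_iX$. For $x\in R$, $S/x$ is the cofiber of $x:S\to S$; for $I=(x_1,\dots,x_n)$, $S/I=S/x_1\wedge\cdots\wedge S/x_n$ (the Koszul complex). The object $S/I$ depends on the chosen generators, but the thick subcategory $\mathbf{thick}\langle S/I\rangle$ does not. Here $\mathbf{thick}\langle Z\rangle$ is the smallest class of objects containing $Z$ and closed under (de)suspension, retracts and cofiber sequences (two-out-of-three in exact triangles). For a class $\mathcal{C}$ of objects, $\mathcal{GH}_{\mathcal{C}}$ is the statement: if $f:X\to Y$ is a morphism between objects of $\mathcal{C}$ and $\pi_*f=0$, then $f=0$. ''$I$ is a ring summand of $R$'' means that $R=I\times R/I$ as a direct product of rings, i.e. $I=eR$ for an idempotent $e\in R$. A ring $T$ is von Neumann regular if for every $x\in T$ there is $y\in T$ with $xyx=x$. *)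

(* Defs.v *)
From HB Require Import structures.
From mathcomp Require Import all_boot all_order all_algebra.
From mathcomp Require Import boolp.

Set Implicit Arguments.
Unset Strict Implicit.
Unset Printing Implicit Defensive.

Import GRing.Theory.
Local Open Scope ring_scope.
Local Open Scope quotient_scope.

(* Rings are allowed to be trivial (pzRingType): R may be the zero ring, and so
   may R / I, since the ideal I may be the whole of R. *)

Definition von_neumann_regular (T : pzRingType) : Prop :=
  forall x : T, exists y : T, x * y * x = x.

Definition ring_summand (R : comPzRingType) (I : {pred R}) : Prop :=
  exists2 e : R, e * e = e & forall a : R, a \in I <-> exists r : R, a = e * r.

Section IdealQuotient.
Variables (R : comPzRingType) (xs : seq R).

Definition ideal : {pred R} :=
  fun a => `[< exists c : 'I_(size xs) -> R, a = \sum_i c i * xs`_i >].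

Lemma idealP a :
  reflect (exists c : 'I_(size xs) -> R, a = \sum_i c i * xs`_i) (a \in ideal).
Proof. exact: asboolP. Qed.

Fact ideal_zmod_closed : zmod_closed ideal.
Proof.
split; first by apply/idealP; exists (fun=> 0); rewrite big1 // => i _; rewrite mul0r.
move=> a b /idealP[c ->] /idealP[c' ->]; apply/idealP.
exists (fun i => c i - c' i); rewrite -sumrB.
by apply: eq_bigr => i _; rewrite mulrBl.
Qed.

HB.instance Definition _ := GRing.isZmodClosed.Build R ideal ideal_zmod_closed.

Lemma idealMr a b : b \in ideal -> a * b \in ideal.
Proof.
move=> /idealP[c ->]; apply/idealP; exists (fun i => a * c i).
by rewrite mulr_sumr; apply: eq_bigr => i _; rewrite mulrA.
Qed.

(* ring_quotient provides the quotient group R / I, but its multiplication only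
   for proper ideals of nontrivial rings. *)
Definition ideal_quot : Type := Quotient.quot ideal.

HB.instance Definition _ := GRing.Zmodule.on ideal_quot.
HB.instance Definition _ : EqQuotient R (Quotient.equiv ideal) ideal_quot :=
  EqQuotient.on ideal_quot.

Definition iquot_one : ideal_quot := lift_cst ideal_quot 1.
Definition iquot_mul := lift_op2 ideal_quot *%R.

Fact pi_iquot_mul : {morph \pi_(ideal_quot) : a b / a * b >-> iquot_mul a b}.
Proof.
move=> a b; unlock iquot_mul; apply/eqP; rewrite piE /Quotient.equiv.
rewrite -[_ * _](addrNK (a * repr (\pi_(ideal_quot) b))) -mulrBr -addrA -mulrBl.
rewrite rpredD //; first by rewrite idealMr // Quotient.idealrBE reprK.
by rewrite mulrC idealMr // Quotient.idealrBE reprK.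
Qed.

Canonical pi_iquot_one_morph := PiConst iquot_one.
Canonical pi_iquot_mul_morph := PiMorph2 pi_iquot_mul.

Fact iquot_mulA : associative iquot_mul.
Proof. by move=> a b c; rewrite -[a]reprK -[b]reprK -[c]reprK !piE mulrA. Qed.

Fact iquot_mulC : commutative iquot_mul.
Proof. by move=> a b; rewrite -[a]reprK -[b]reprK !piE mulrC. Qed.

Fact iquot_mul1 : left_id iquot_one iquot_mul.
Proof. by move=> a; rewrite -[a]reprK !piE mul1r. Qed.

Fact iquot_mulDl : left_distributive iquot_mul +%R.
Proof.
have piD : {morph \pi_(ideal_quot) : a b / a + b >-> a + b} by exact: Quotient.pi_add.
move=> a b c; rewrite -[a]reprK -[b]reprK -[c]reprK -piD.
by rewrite -!pi_iquot_mul mulrDl piD.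
Qed.

HB.instance Definition _ := GRing.Zmodule_isComPzRing.Build ideal_quot
  iquot_mulA iquot_mulC iquot_mul1 iquot_mulDl.

End IdealQuotient.

(* Unbounded chain complexes, with differential of degree -1.  The degree n - 1
   is always written prevz n, so that dependent types agree syntactically. *)

Definition prevz (n : int) : int := n - 1.

Record complex (R : comPzRingType) := Complex {
  obj :> int -> lmodType R;
  diff : forall n : int, {linear obj n -> obj (prevz n)};
  diff2 : forall (n : int) x, diff (prevz n) (diff n x) = 0
}.
Arguments diff {R} X n : rename.

Record chain_map (R : comPzRingType) (X Y : complex R) := ChainMap {
  cmap :> forall n : int, {linear X n -> Y n};
  cmapP : forall (n : int) x, cmap (prevz n) (diff X n x) = diff Y n (cmap n x)
}.

Section Complexes.
Variable R : comPzRingType.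
Implicit Types X Y Z P T : complex R.

Program Definition cid X : chain_map X X := @ChainMap R X X (fun n => idfun) _.

Program Definition ccomp X Y Z (g : chain_map Y Z) (f : chain_map X Y) :
  chain_map X Z := @ChainMap R X Z (fun n => (g n \o f n)%FUN) _.
Next Obligation. by rewrite !cmapP. Qed.

Program Definition czero X Y : chain_map X Y :=
  @ChainMap R X Y (fun n => \0) _.
Next Obligation. by rewrite raddf0. Qed.

Program Definition cscale X (a : R) : chain_map X X :=
  @ChainMap R X X (fun n => a \*: idfun) _.
Next Obligation. by rewrite linearZ. Qed.

(* Cycles and boundaries in degree n - 1; this covers all degrees, and boundary
   needs no transport from degree (n + 1) - 1 to degree n. *)
Definition cycle X (n : int) (z : X (prevz n)) := diff X (prevz n) z = 0.
Definition boundary X (n : int) (z : X (prevz n)) := exists w : X n, diff X n w = z.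

Definition acyclic X := forall (n : int) (z : X (prevz n)), cycle z -> boundary z.

Definition quasi_iso X Y (s : chain_map X Y) : Prop :=
  forall n : int,
    (forall z : X (prevz n), cycle z -> boundary (s _ z) -> boundary z) /\
    (forall w : Y (prevz n), cycle w ->
       exists2 z : X (prevz n), cycle z & boundary (w - s _ z)).

(* Suspension: (susp X)_n = X_(n-1), with differential -d. *)
Program Definition susp X : complex R :=
  @Complex R (fun n => X (prevz n)) (fun n => \- diff X (prevz n)) _.
Next Obligation. by rewrite raddfN /= opprK diff2. Qed.

Program Definition csusp X Y (f : chain_map X Y) : chain_map (susp X) (susp Y) :=
  @ChainMap R (susp X) (susp Y) (fun n => f (prevz n)) _.
Next Obligation. by rewrite raddfN /= cmapP. Qed.

Lemma quasi_iso_susp X Y (s : chain_map X Y) : quasi_iso s -> quasi_iso (csusp s).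
Proof.
have bN (W : complex R) n (z : W (prevz (prevz n))) :
    @boundary (susp W) n z <-> boundary z.
  by split=> -[w <-]; exists (- w); rewrite /= raddfN ?opprK.
have cN (W : complex R) n (z : W (prevz (prevz n))) :
    @cycle (susp W) n z <-> cycle z.
  rewrite /cycle /=; split; last by move=> ->; rewrite oppr0.
  by move/(congr1 -%R); rewrite opprK oppr0.
move=> qs n; have [inj surj] := qs (prevz n); split.
  by move=> z /cN cz /bN bz; apply/bN/inj.
by move=> w /cN /surj [z cz bz]; exists z; [apply/cN|apply/bN].
Qed.

(* The cofiber (mapping cone) of f: X -> Y is Y_n (+) X_(n-1) in degree n, with
   differential (y, x) |-> (d y + f x, - d x). *)
Section Cone.
Variables (X Y : complex R) (f : chain_map X Y).

Definition cone_obj (n : int) : lmodType R := (Y n * X (prevz n))%type.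

Definition cone_diff_fun n (v : cone_obj n) : cone_obj (prevz n) :=
  (diff Y n v.1 + f (prevz n) v.2, - diff X (prevz n) v.2).

Fact cone_diff_linear n : linear (@cone_diff_fun n).
Proof.
move=> a u v; rewrite /cone_diff_fun; congr pair => /=.
  by rewrite !linearP scalerDr addrACA.
by rewrite !linearP.
Qed.

HB.instance Definition _ n := GRing.isLinear.Build R (cone_obj n)
  (cone_obj (prevz n)) _ (@cone_diff_fun n) (@cone_diff_linear n).

Program Definition cone : complex R :=
  @Complex R cone_obj (fun n => @cone_diff_fun n) _.
Next Obligation.
rewrite /cone_diff_fun /= raddfD /= diff2 add0r !raddfN /= cmapP subrr diff2 ?oppr0 //.
Qed.

Definition cone_in_fun n (y : Y n) : cone n := (y, 0).
Fact cone_in_linear n : linear (@cone_in_fun n).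
Proof. by move=> a u v; rewrite /cone_in_fun; congr pair; rewrite /= scaler0 addr0. Qed.
HB.instance Definition _ n := GRing.isLinear.Build R (Y n) (cone n) _
  (@cone_in_fun n) (@cone_in_linear n).

Program Definition cone_in : chain_map Y cone :=
  @ChainMap R Y cone (fun n => @cone_in_fun n) _.
Next Obligation.
by rewrite /cone_in_fun /cone_diff_fun /= !raddf0 addr0.
Qed.

Definition cone_out_fun n (v : cone n) : susp X n := v.2.
Fact cone_out_linear n : linear (@cone_out_fun n). Proof. by []. Qed.
HB.instance Definition _ n := GRing.isLinear.Build R (cone n) (susp X n) _
  (@cone_out_fun n) (@cone_out_linear n).

Program Definition cone_out : chain_map cone (susp X) :=
  @ChainMap R cone (susp X) (fun n => @cone_out_fun n) _.

End Cone.

(* Sigma^i S: the free module of rank 1 in degree i, and 0 elsewhere. *)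
Program Definition sphere (i : int) : complex R :=
  @Complex R (fun n => 'rV[R]_(n == i)) (fun n => \0) _.

(* The derived category is the localization of the category of complexes at the
   quasi-isomorphisms (Gabriel-Zisman): a morphism is represented by a formal
   composite of chain maps and inverses of quasi-isomorphisms, and two of these
   are equal when they are related by the congruence deq. *)
Inductive dmap : complex R -> complex R -> Type :=
| dmap_of X Y (f : chain_map X Y) : dmap X Y
| dmap_inv X Y (s : chain_map X Y) (qs : quasi_iso s) : dmap Y X
| dcomp X Y Z (g : dmap Y Z) (f : dmap X Y) : dmap X Z.

Inductive deq : forall X Y, dmap X Y -> dmap X Y -> Prop :=
| deq_refl X Y (f : dmap X Y) : deq f f
| deq_sym X Y (f g : dmap X Y) : deq f g -> deq g f
| deq_trans X Y (f g h : dmap X Y) : deq f g -> deq g h -> deq f h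
| deq_comp X Y Z (g g' : dmap Y Z) (f f' : dmap X Y) :
    deq g g' -> deq f f' -> deq (dcomp g f) (dcomp g' f')
| deq_assoc X Y Z W (h : dmap Z W) (g : dmap Y Z) (f : dmap X Y) :
    deq (dcomp h (dcomp g f)) (dcomp (dcomp h g) f)
| deq_idl X Y (f : dmap X Y) : deq (dcomp (dmap_of (cid Y)) f) f
| deq_idr X Y (f : dmap X Y) : deq (dcomp f (dmap_of (cid X))) f
| deq_of X Y (f g : chain_map X Y) :
    (forall n x, f n x = g n x) -> deq (dmap_of f) (dmap_of g)
| deq_of_comp X Y Z (g : chain_map Y Z) (f : chain_map X Y) :
    deq (dmap_of (ccomp g f)) (dcomp (dmap_of g) (dmap_of f))
| deq_invl X Y (s : chain_map X Y) (qs : quasi_iso s) :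
    deq (dcomp (dmap_inv qs) (dmap_of s)) (dmap_of (cid X))
| deq_invr X Y (s : chain_map X Y) (qs : quasi_iso s) :
    deq (dcomp (dmap_of s) (dmap_inv qs)) (dmap_of (cid Y)).

Definition did X : dmap X X := dmap_of (cid X).
Definition dzero X Y : dmap X Y := dmap_of (czero X Y).

Definition is_diso X Y (f : dmap X Y) : Prop :=
  exists g : dmap Y X, deq (dcomp g f) (did X) /\ deq (dcomp f g) (did Y).

Definition diso X Y : Prop := exists f : dmap X Y, is_diso f.

Fixpoint dsusp X Y (f : dmap X Y) : dmap (susp X) (susp Y) :=
  match f with
  | dmap_of _ _ f => dmap_of (csusp f)
  | dmap_inv _ _ _ qs => dmap_inv (quasi_iso_susp qs)
  | dcomp _ _ _ g f => dcomp (dsusp g) (dsusp f)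
  end.

(* X -f-> Y -g-> Z -h-> susp X is exact when it is isomorphic, in the derived
   category, to the cofiber sequence A -> B -> cone u -> susp A of a chain map. *)
Definition exact_triangle X Y Z (f : dmap X Y) (g : dmap Y Z)
    (h : dmap Z (susp X)) : Prop :=
  exists A B (u : chain_map A B)
    (a : dmap A X) (b : dmap B Y) (c : dmap (cone u) Z),
    [/\ is_diso a, is_diso b & is_diso c] /\
    [/\ deq (dcomp f a) (dcomp b (dmap_of u)),
        deq (dcomp g b) (dcomp c (dmap_of (cone_in u)))
      & deq (dcomp h c) (dcomp (dsusp a) (dmap_of (cone_out u)))].

(* Isomorphic objects are retracts of each other, so that thick Z is closed
   under isomorphism, and thick_desusp is closure under desuspension. *)
Inductive thick (Z : complex R) : complex R -> Prop :=
| thick_gen : thick Z Z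
| thick_susp X : thick Z X -> thick Z (susp X)
| thick_desusp X : thick Z (susp X) -> thick Z X
| thick_retract X Y (i : dmap X Y) (r : dmap Y X) :
    deq (dcomp r i) (did X) -> thick Z Y -> thick Z X
| thick_cofiber1 A B C (f : dmap A B) (g : dmap B C) (h : dmap C (susp A)) :
    exact_triangle f g h -> thick Z B -> thick Z C -> thick Z A
| thick_cofiber2 A B C (f : dmap A B) (g : dmap B C) (h : dmap C (susp A)) :
    exact_triangle f g h -> thick Z A -> thick Z C -> thick Z B
| thick_cofiber3 A B C (f : dmap A B) (g : dmap B C) (h : dmap C (susp A)) :
    exact_triangle f g h -> thick Z A -> thick Z B -> thick Z C.

(* pi_i X = Hom(Sigma^i S, X), and pi_i f is postcomposition with f. *)
Definition pi_eq0 X Y (f : dmap X Y) : Prop :=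
  forall (i : int) (a : dmap (sphere i) X),
    deq (dcomp f a) (dzero (sphere i) Y).

Definition GH (C : complex R -> Prop) : Prop :=
  forall X Y (f : dmap X Y), C X -> C Y -> pi_eq0 f -> deq f (dzero X Y).

(* Tensor products are described by their universal property: T_n is the direct
   sum over i + j = n of the P_i (x) Y_j when every family of bilinear maps
   P_i x Y_j -> M factors through a unique linear map T_n -> M.  The maps
   t i j n, and b i j below, are only relevant for i + j = n. *)
Definition bilinear_map (U V W : lmodType R) (b : U -> V -> W) : Prop :=
  (forall u, linear (b u)) /\ (forall v, linear (b^~ v)).

Definition is_tensor P Y T : Prop :=
  exists t : forall i j n : int, P i -> Y j -> T n,
  [/\ forall i j n : int, i + j = n :> int -> bilinear_map (t i j n),
      forall i j n : int, i + j = n :> int -> forall (p : P i) (y : Y j),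
        diff T n (t i j n p y) =
        t (prevz i) j (prevz n) (diff P i p) y
        + (-1) ^+ `|i|%N *: t i (prevz j) (prevz n) p (diff Y j y),
      forall (n : int) (M : lmodType R) (b : forall i j : int, P i -> Y j -> M),
        (forall i j : int, i + j = n :> int -> bilinear_map (b i j)) ->
        exists g : {linear T n -> M},
          forall i j : int, i + j = n :> int -> forall p y, g (t i j n p y) = b i j p y
    & forall (n : int) (M : lmodType R) (g g' : {linear T n -> M}),
        (forall i j : int, i + j = n :> int -> forall p y, g (t i j n p y) = g' (t i j n p y)) ->
        g =1 g'].

Definition K_flat P : Prop :=
  forall A T, acyclic A -> is_tensor P A T -> acyclic T.

(* Z is isomorphic to the derived tensor product of X and Y, which is computed
   by a K-flat resolution P of X. *)
Definition is_derived_tensor X Y Z : Prop :=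
  exists P T (s : chain_map P X),
    [/\ quasi_iso s, K_flat P, is_tensor P Y T & diso T Z].

Definition cofiber_mul (x : R) : complex R := cone (cscale (sphere 0) x).

(* K is (isomorphic to) S/x_1 /\ ... /\ S/x_n; the empty product is S. *)
Fixpoint is_koszul (xs : seq R) (K : complex R) : Prop :=
  match xs with
  | [::] => diso (sphere 0) K
  | x :: xs' => exists2 K', is_koszul xs' K'
                          & is_derived_tensor K' (cofiber_mul x) K
  end.

End Complexes.

(* Main.v *)
From HB Require Import structures.
From mathcomp Require Import all_boot all_order all_algebra.
From mathcomp Require Import boolp.
Require Import Defs.

(** Let x_1, ..., x_n generate the ideal I, with annihilator J.  Each cone that
    builds S/I is the cone of multiplication by an x_i, so S/I may be replaced
    by the explicit Koszul complex kos xs (sphere R 0) (diso_koszul), a bounded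
    complex of free modules on which every x_i is null homotopic
    (kos_scale_null).  Morphisms of the derived category out of it, which are
    formal zigzags, are homotopy classes of chain maps (deq_homotopic,
    hrel_dcomp).

    From the generating hypothesis to the ring.  The Koszul complex K projects
    to its top cell, a sphere S^n.  A cycle of K projects to an element of J,
    and precomposition with the projection is injective on maps into a complex
    killed by the x_i.  Hence, under the hypothesis, a map from S^n to such a
    complex of the thick subcategory is zero as soon as it kills J
    (GH_kos_top).  Applied to multiples of the bottom and of the top cell of K,
    this gives two statements about every list of generators whose Koszul
    complex lies in the thick subcategory: if c J is contained in I then c is in
    I (GH_ideal_ann), and if w in J satisfies w J = 0 then w = 0 (GH_ann_nil),
    so that I and J meet trivially.  Squaring a generator stays in the thick
    subcategory by the octahedral axiom (thick_kos_sq).  Comparing a list with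
    the one where x is squared, if r annihilates the second ideal, then x r
    lies in both the first ideal and its annihilator and vanishes; so x belongs
    to the second ideal (GH_ideal_sq).  Doing this for all the x_i in turn gives
    I = I^2, whence an idempotent generator (ring_summand_sq), and doing it for
    an additional generator x gives regularity of R / I.

    From the ring to the generating hypothesis.  Let I = eR with R / I von
    Neumann regular.  Over a von Neumann regular ring, kernels and cokernels of
    maps between finitely generated projective modules are finitely generated
    projective and extensions of such modules split (factors_free_five).  The
    long exact sequence then shows that the complexes whose homology modules are
    finitely generated projective over R / I form a thick subcategory
    (fgp_homology_thick), which contains K.  A complex with projective homology
    is isomorphic to its homology (homology_complex_model), a sum of shifted
    projective modules, on which a morphism is determined by its effect on
    homotopy (fgp_homology_GH). *)

Set Implicit Arguments.
Unset Strict Implicit.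
Unset Printing Implicit Defensive.

Import GRing.Theory.
Local Open Scope ring_scope.
Local Open Scope quotient_scope.

(** * Homotopies and the derived category *)

(** Bundles a function with a proof of linearity, so that a chain map can be
    assembled from explicit formulas without naming each component. *)
Definition linmap (R : pzRingType) (U V : lmodType R) (f : U -> V) (H : linear f) :
  {linear U -> V} := HB.pack f (GRing.isLinear.Build R U V _ f H).

Lemma prevzK n : prevz (n + 1) = n.
Proof. by rewrite /prevz addrK. Qed.

Lemma prevz_inj : injective prevz.
Proof. exact: addIr. Qed.

Lemma prevz_ind (P : int -> Prop) : (forall n, P (prevz n)) -> forall n, P n.
Proof. by move=> H n; rewrite -(prevzK n). Qed.

(** Differentials and homotopies live in degrees of the form prevz n; a family
    indexed by those degrees is a family indexed by all degrees, because every
    integer is some prevz n.  The cast is computed away by unprevE. *)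
Definition unprev (F : int -> Type) (b : forall n, F (prevz n)) (m : int) : F m :=
  eq_rect _ F (b (m + 1)) m (prevzK m).

Lemma unprevE (F : int -> Type) (b : forall n, F (prevz n)) n :
  unprev b (prevz n) = b n.
Proof.
rewrite /unprev; move: (prevzK (prevz n)).
have -> : prevz n + 1 = n by rewrite /prevz subrK.
by move=> E; rewrite (eq_irrelevance E erefl).
Qed.

Section Basics.
Variable R : comPzRingType.
Implicit Types X Y Z W P A B C : complex R.

(** Stated for families of functions rather than chain maps, so that it applies
    to differences of chain maps and to multiplication by a scalar.  The
    homotopy is indexed by its target degree, hence no transport is needed. *)
Definition nullhomotopic X Y (phi : forall n, X n -> Y n) : Prop :=
  exists h : forall n, {linear X (prevz n) -> Y n}, forall n (x : X (prevz n)),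
    phi (prevz n) x = diff Y n (h n x) + h (prevz n) (diff X (prevz n) x).

Definition homotopic X Y (f g : chain_map X Y) : Prop :=
  nullhomotopic (fun n x => f n x - g n x).

Lemma nullhomotopic_ext X Y (phi psi : forall n, X n -> Y n) :
  (forall n x, phi n x = psi n x) -> nullhomotopic psi -> nullhomotopic phi.
Proof. by move=> E [h hP]; exists h => n x; rewrite E. Qed.

Lemma nullhomotopicD X Y (phi psi : forall n, X n -> Y n) :
  nullhomotopic phi -> nullhomotopic psi ->
  nullhomotopic (fun n x => phi n x + psi n x).
Proof.
move=> [h hP] [k kP]; exists (fun n => (h n \+ k n)%FUN) => n x /=.
by rewrite hP kP raddfD /= addrACA.
Qed.

Lemma nullhomotopicN X Y (phi : forall n, X n -> Y n) :
  nullhomotopic phi -> nullhomotopic (fun n x => - phi n x).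
Proof.
move=> [h hP]; exists (fun n => (\- h n)%FUN) => n x /=.
by rewrite hP raddfN /= opprD.
Qed.

Lemma nullhomotopic_compl X Y Z (g : chain_map Y Z) (phi : forall n, X n -> Y n) :
  nullhomotopic phi -> nullhomotopic (fun n x => g n (phi n x)).
Proof.
move=> [h hP]; exists (fun n => (g n \o h n)%FUN) => n x /=.
by rewrite hP raddfD /= cmapP.
Qed.

Lemma nullhomotopic_compr X Y Z (phi : forall n, Y n -> Z n) (f : chain_map X Y) :
  nullhomotopic phi -> nullhomotopic (fun n x => phi n (f n x)).
Proof.
move=> [h hP]; exists (fun n => (h n \o f (prevz n))%FUN) => n x /=.
by rewrite hP cmapP.
Qed.

Lemma nullhomotopic0 X Y : nullhomotopic (fun n (_ : X n) => 0 : Y n).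
Proof. by exists (fun n => \0) => n x /=; rewrite raddf0 add0r. Qed.

Lemma homotopic_refl X Y (f : chain_map X Y) : homotopic f f.
Proof.
by apply: nullhomotopic_ext (nullhomotopic0 X Y) => n x; rewrite subrr.
Qed.

Lemma homotopic_sym X Y (f g : chain_map X Y) : homotopic f g -> homotopic g f.
Proof.
by move/nullhomotopicN; apply: nullhomotopic_ext => n x; rewrite opprB.
Qed.

Lemma homotopic_trans X Y (f g h : chain_map X Y) :
  homotopic f g -> homotopic g h -> homotopic f h.
Proof.
move=> fg gh; have := nullhomotopicD fg gh.
by apply: nullhomotopic_ext => n x; rewrite addrA subrK.
Qed.

Lemma homotopic_compl X Y Z (g : chain_map Y Z) (f f' : chain_map X Y) :
  homotopic f f' -> homotopic (ccomp g f) (ccomp g f').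
Proof.
move=> /(nullhomotopic_compl g); apply: nullhomotopic_ext => n x /=.
by rewrite raddfB.
Qed.

Lemma deq_compl X Y Z (g : dmap Y Z) (f f' : dmap X Y) :
  deq f f' -> deq (dcomp g f) (dcomp g f').
Proof. by move=> H; apply: deq_comp H; apply: deq_refl. Qed.

Lemma deq_compr X Y Z (g g' : dmap Y Z) (f : dmap X Y) :
  deq g g' -> deq (dcomp g f) (dcomp g' f).
Proof. by move=> H; apply: deq_comp; [exact: H|apply: deq_refl]. Qed.

Lemma is_diso_dcomp X Y Z (g : dmap Y Z) (f : dmap X Y) :
  is_diso g -> is_diso f -> is_diso (dcomp g f).
Proof.
move=> [g' [g'g gg']] [f' [f'f ff']]; exists (dcomp f' g'); split.
  apply: deq_trans (deq_assoc _ _ _) _.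
  apply: deq_trans f'f; apply: deq_compr.
  apply: deq_trans (deq_sym (deq_assoc _ _ _)) _.
  apply: deq_trans (deq_compl _ g'g) (deq_idr _).
apply: deq_trans (deq_assoc _ _ _) _.
apply: deq_trans gg'; apply: deq_compr.
apply: deq_trans (deq_sym (deq_assoc _ _ _)) _.
apply: deq_trans (deq_compl _ ff') (deq_idr _).
Qed.

Lemma is_diso_did X : is_diso (did X).
Proof. by exists (did X); split; apply: deq_idl. Qed.

Lemma is_diso_quasi_iso X Y (s : chain_map X Y) : quasi_iso s -> is_diso (dmap_of s).
Proof.
by move=> qs; exists (dmap_inv qs); split; [apply: deq_invl|apply: deq_invr].
Qed.

Lemma diso_refl X : diso X X.
Proof. by exists (did X); apply: is_diso_did. Qed.

Lemma diso_sym X Y : diso X Y -> diso Y X.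
Proof. by move=> [f [g [gf fg]]]; exists g, f. Qed.

Lemma diso_trans X Y Z : diso X Y -> diso Y Z -> diso X Z.
Proof.
by move=> [f df] [g dg]; exists (dcomp g f); apply: is_diso_dcomp.
Qed.

Lemma diso_quasi_iso X Y (s : chain_map X Y) : quasi_iso s -> diso X Y.
Proof. by move=> qs; exists (dmap_of s); apply: is_diso_quasi_iso. Qed.

Lemma quasi_iso_bij X Y (s : chain_map X Y) :
  (forall n, bijective (s n)) -> quasi_iso s.
Proof.
move=> bs n; split.
  move=> z cz [w dw]; have [t tK Kt] := bs n; exists (t w).
  apply: (bij_inj (bs _)); by rewrite cmapP Kt.
move=> w cw; have [t tK Kt] := bs (prevz n); exists (t w).
  apply: (bij_inj (bs _)); by rewrite cmapP Kt raddf0.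
by exists 0; rewrite Kt subrr raddf0.
Qed.

Section Cylinder.
Variable X : complex R.

(** The mapping cylinder of the identity: two copies of X glued along a copy of
    X shifted by one, so that chain maps out of it are homotopies. *)
Definition cyl_obj (n : int) : lmodType R := (X n * X n * X (prevz n))%type.

Definition cyl_diff_fun n (v : cyl_obj n) : cyl_obj (prevz n) :=
  (diff X n v.1.1 + v.2, diff X n v.1.2 - v.2, - diff X (prevz n) v.2).

Fact cyl_diff_linear n : linear (@cyl_diff_fun n).
Proof.
move=> a u v; rewrite /cyl_diff_fun /=; congr (_, _, _) => /=; rewrite !linearP //=.
  by rewrite scalerDr addrACA.
by rewrite scalerDr addrACA.
Qed.

Program Definition cyl : complex R :=
  @Complex R cyl_obj (fun n => linmap (@cyl_diff_linear n)) _.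
Next Obligation.
by rewrite /cyl_diff_fun /= raddfD raddfB /= !raddfN /= !diff2 !add0r opprK subrr addNr !oppr0.
Qed.

Definition cyl_in1_fun n (x : X n) : cyl n := (x, 0, 0).
Fact cyl_in1_linear n : linear (@cyl_in1_fun n).
Proof.
by move=> a u v; rewrite /cyl_in1_fun; congr (_, _, _); rewrite /= scaler0 addr0.
Qed.
Program Definition cyl_in1 : chain_map X cyl :=
  @ChainMap R X cyl (fun n => linmap (@cyl_in1_linear n)) _.
Next Obligation.
by rewrite /cyl_in1_fun /cyl_diff_fun /= !raddf0 /= !(addr0, subr0).
Qed.

Definition cyl_in2_fun n (x : X n) : cyl n := (0, x, 0).
Fact cyl_in2_linear n : linear (@cyl_in2_fun n).
Proof.
by move=> a u v; rewrite /cyl_in2_fun; congr (_, _, _); rewrite /= scaler0 addr0.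
Qed.
Program Definition cyl_in2 : chain_map X cyl :=
  @ChainMap R X cyl (fun n => linmap (@cyl_in2_linear n)) _.
Next Obligation.
by rewrite /cyl_in2_fun /cyl_diff_fun /= !raddf0 /= !(addr0, subr0).
Qed.

Definition cyl_out_fun n (v : cyl n) : X n := v.1.1 + v.1.2.
Fact cyl_out_linear n : linear (@cyl_out_fun n).
Proof. by move=> a u v; rewrite /cyl_out_fun /= scalerDr addrACA. Qed.
Program Definition cyl_out : chain_map cyl X :=
  @ChainMap R cyl X (fun n => linmap (@cyl_out_linear n)) _.
Next Obligation.
by rewrite /cyl_out_fun /cyl_diff_fun /= addrACA subrr addr0 raddfD.
Qed.

(** The fold map collapses the cylinder onto one end.  If a cycle (a, b, p)
    has image a + b = d w, then it is the boundary of (w, 0, - b). *)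
Lemma quasi_iso_cyl_out : quasi_iso cyl_out.
Proof.
move=> n; split.
  move=> [[a b] p]; rewrite /cycle /= /cyl_diff_fun /= => -[] dap dbp _ [w] /=.
  rewrite /cyl_out_fun /= => dw; exists (w, 0, - b); rewrite /= /cyl_diff_fun /=.
  rewrite raddf0 sub0r opprK dw addrK; congr (_, _, _).
  by rewrite raddfN opprK; apply/eqP; rewrite -subr_eq0 dbp.
move=> w cw; exists (w, 0, 0); last first.
  by exists 0; rewrite /= /cyl_out_fun /= addr0 subrr raddf0.
by rewrite /cycle /= /cyl_diff_fun /= cw !raddf0 add0r.
Qed.

End Cylinder.

(** The two ends of the cylinder are both right inverse to the fold map, which is
    invertible in the derived category, so they become equal there; a homotopy
    from f to g is a map out of the cylinder restricting to f and g at the ends. *)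
Lemma homotopic_deq X Y (f g : chain_map X Y) :
  homotopic f g -> deq (dmap_of f) (dmap_of g).
Proof.
move=> [h hP].
pose F n (v : cyl X n) : Y n := f n v.1.1 + g n v.1.2 + h n v.2.
have F_lin n : linear (@F n).
  move=> a u v; rewrite /F /= !linearP /= !scalerDr.
  by rewrite (addrACA _ (f n v.1.1)) [LHS]addrACA.
have Fd n (v : cyl X n) : F (prevz n) (diff (cyl X) n v) = diff Y n (F n v).
  case: v => [[a b] p]; rewrite /F /= /cyl_diff_fun /= !raddfD /= !raddfN /=.
  rewrite -!cmapP; have := hP n p => /eqP; rewrite -subr_eq => /eqP <-.
  by rewrite [X in X - _]addrACA -!addrA.
pose F' : chain_map (cyl X) Y := @ChainMap R _ _ (fun n => linmap (F_lin n)) Fd.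
have io : deq (dmap_of (cyl_in1 X)) (dmap_of (cyl_in2 X)).
  pose q := quasi_iso_cyl_out X.
  have cancelq (i : chain_map X (cyl X)) :
      (forall n x, cyl_out X n (i n x) = x) -> deq (dmap_of i) (dmap_inv q).
    move=> iP; apply: deq_trans (deq_sym (deq_idl _)) _.
    apply: deq_trans (deq_compr _ (deq_sym (deq_invl q))) _.
    apply: deq_trans (deq_sym (deq_assoc _ _ _)) _.
    apply: deq_trans (deq_idr _); apply: deq_compl.
    apply: deq_trans (deq_sym (deq_of_comp _ _)) _.
    by apply: deq_of => n x; rewrite /= -[RHS]iP.
  apply: deq_trans (cancelq _ _) (deq_sym (cancelq _ _)) => n x /=;
    by rewrite /cyl_out_fun /= ?addr0 ?add0r.
have E1 : deq (dmap_of f) (dcomp (dmap_of F') (dmap_of (cyl_in1 X))).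
  apply: deq_trans (deq_of_comp _ _); apply: deq_of => n x.
  by rewrite /= /F /= !raddf0 !addr0.
have E2 : deq (dmap_of g) (dcomp (dmap_of F') (dmap_of (cyl_in2 X))).
  apply: deq_trans (deq_of_comp _ _); apply: deq_of => n x.
  by rewrite /= /F /= !raddf0 add0r addr0.
apply: deq_trans E1 (deq_trans _ (deq_sym E2)).
exact: deq_compl.
Qed.

End Basics.

(** * Cones of multiplications and Koszul complexes *)

Section ConeOfMultiplication.
Variable R : comPzRingType.
Implicit Types X Y Z P A B : complex R.

(** The cofiber of multiplication by a on X, a model of the derived tensor product
    of X with S/a. *)
Definition cmul (a : R) X : complex R := cone (cscale X a).

Lemma cmul_diff (a : R) X n (v : cmul a X n) :
  diff (cmul a X) n v = (diff X n v.1 + a *: v.2, - diff X (prevz n) v.2).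
Proof. by []. Qed.

Section Functor.
Variables (a : R) (X Y : complex R) (f : chain_map X Y).

Definition ccone_fun n (v : cmul a X n) : cmul a Y n := (f n v.1, f (prevz n) v.2).
Fact ccone_linear n : linear (@ccone_fun n).
Proof. by move=> b u v; rewrite /ccone_fun /= !linearP. Qed.
Fact ccone_chain n (v : cmul a X n) :
  ccone_fun (diff (cmul a X) n v) = diff (cmul a Y) n (ccone_fun v).
Proof.
by rewrite !cmul_diff /ccone_fun /= linearD linearZ linearN /= !cmapP.
Qed.
Definition ccone : chain_map (cmul a X) (cmul a Y) :=
  @ChainMap R _ _ (fun n => linmap (@ccone_linear n)) ccone_chain.

End Functor.

(** The five lemma, chased on elements, for the long exact sequences of the two
    cones. *)
Lemma quasi_iso_ccone a X Y (s : chain_map X Y) :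
  quasi_iso s -> quasi_iso (ccone a s).
Proof.
move=> qs n; split.
  move=> [u p]; rewrite /cycle cmul_diff /= => -[] du /eqP.
  rewrite oppr_eq0 => /eqP dp [[w q]]; rewrite cmul_diff => -[/= dw dq].
  have [injn surjn] := qs n; have [inj' _] := qs (prevz n).
  (* The choice of p0 is corrected by a cycle r, so that the first component that
     remains, u - a (r - p0), becomes a boundary too. *)
  have [p0 dp0] : boundary p.
    by apply: inj' => //; exists (- q); rewrite raddfN.
  have [r cr [t dt]] : exists2 r, cycle r & boundary (q + s _ p0 - s _ r).
    apply: surjn; rewrite /cycle raddfD /= -cmapP dp0 -dq.
    by rewrite addrN.
  have [w' dw'] : boundary (u - a *: (r - p0)).
    apply: injn.
      by rewrite /cycle raddfB /= linearZ linearB /= cr dp0 sub0r scalerN opprK.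
    rewrite linearB linearZ linearB /= -dw.
    exists (w + a *: t); rewrite raddfD /= linearZ /= dt.
    by rewrite -[RHS]addrA -scalerBr opprB addrA addrAC.
  exists (w', r - p0); rewrite cmul_diff /= dw' subrK raddfB /= cr dp0 sub0r opprK //.
move=> [y q]; rewrite /cycle cmul_diff /= => -[] dy /eqP.
rewrite oppr_eq0 => /eqP dq.
have [_ surjn] := qs n; have [inj' surj'] := qs (prevz n).
have [p cp [t dt]] := surj' q dq.
have [u du] : boundary (a *: p).
  apply: inj'; first by rewrite /cycle linearZ /= cp scaler0.
  exists (- (y + a *: t)); rewrite raddfN raddfD /= linearZ /= dt scalerBr addrA dy.
  by rewrite sub0r opprK linearZ.
have [r cr [w dw]] : exists2 r, cycle r & boundary (y + s _ u + a *: t - s _ r).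
  apply: surjn; rewrite /cycle !raddfD /= linearZ /= dt -cmapP du linearZ /=.
  by rewrite addrAC scalerBr addrA dy sub0r addrC subrr.
exists (r - u, p); first by rewrite /cycle cmul_diff /= raddfB /= cr du cp sub0r oppr0 addNr.
exists (w, - t); rewrite cmul_diff /= dw; congr pair => /=.
  by rewrite scalerN addrAC addrK raddfB /= opprB -!addrA (addrC (s _ u)).
by rewrite raddfN opprK; apply: dt.
Qed.

(** Since cmul a preserves quasi-isomorphisms, it extends to formal composites of
    chain maps and inverses of quasi-isomorphisms. *)
Fixpoint dcone (a : R) X Y (f : dmap X Y) : dmap (cmul a X) (cmul a Y) :=
  match f with
  | dmap_of _ _ f => dmap_of (ccone a f)
  | dmap_inv _ _ _ qs => dmap_inv (quasi_iso_ccone a qs)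
  | dcomp _ _ _ g f => dcomp (dcone a g) (dcone a f)
  end.

Lemma dcone_deq a X Y (f g : dmap X Y) : deq f g -> deq (dcone a f) (dcone a g).
Proof.
elim=> {X Y f g} /=.
- by move=> X Y f; apply: deq_refl.
- by move=> X Y f g _; apply: deq_sym.
- by move=> X Y f g h _ fg _; apply: deq_trans.
- by move=> X Y Z g g' f f' _ ? _ ?; apply: deq_comp.
- by move=> X Y Z W h g f; apply: deq_assoc.
- move=> X Y f; apply: deq_trans (deq_idl _); apply: deq_compr.
  by apply: deq_of => n [].
- move=> X Y f; apply: deq_trans (deq_idr _); apply: deq_compl.
  by apply: deq_of => n [].
- move=> X Y f g fg; apply: deq_of => n [u p] /=.
  by rewrite /ccone_fun /= !fg.
- move=> X Y Z g f; apply: deq_trans (deq_of_comp _ _).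
  by apply: deq_of => n [].
- move=> X Y s qs; apply: deq_trans (deq_invl _) _.
  by apply: deq_of => n [].
- move=> X Y s qs; apply: deq_trans (deq_invr _) _.
  by apply: deq_of => n [].
Qed.

Lemma diso_cmul a X Y : diso X Y -> diso (cmul a X) (cmul a Y).
Proof.
have Eid Z : deq (dcone a (did Z)) (did (cmul a Z)) by apply: deq_of => n [].
move=> [f [g [/(dcone_deq a) gf /(dcone_deq a) fg]]].
exists (dcone a f), (dcone a g); split.
  exact: deq_trans gf (Eid _).
exact: deq_trans fg (Eid _).
Qed.

Definition cinverse X Y (f : chain_map X Y) (g : chain_map Y X) : Prop :=
  (forall n x, g n (f n x) = x) /\ (forall n y, f n (g n y) = y).

Lemma diso_cinverse X Y (f : chain_map X Y) (g : chain_map Y X) :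
  cinverse f g -> diso X Y.
Proof.
move=> [gf fg]; apply: (@diso_quasi_iso _ _ _ f); apply: quasi_iso_bij => n.
by exists (g n) => x; [apply: gf|apply: fg].
Qed.

Section Swap.
Variables (a b : R) (X : complex R).
(** Cones of two multiplications commute; the sign on the doubly shifted summand
    is the usual one for exchanging two elements of degree one. *)
Definition cswap_fun n (v : cmul a (cmul b X) n) : cmul b (cmul a X) n :=
  (v.1.1, v.2.1, (v.1.2, - v.2.2)).
Fact cswap_linear n : linear (@cswap_fun n).
Proof.
move=> c u v; rewrite /cswap_fun /=; congr (_, _, (_, _)).
by rewrite /= opprD scalerN.
Qed.
Fact cswap_chain n (v : cmul a (cmul b X) n) :
  cswap_fun (diff (cmul a (cmul b X)) n v) = diff (cmul b (cmul a X)) n (cswap_fun v).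
Proof.
rewrite !cmul_diff /cswap_fun /= /cone_diff_fun /=; congr (_, _, (_, _)).
- by rewrite /= addrAC.
- by rewrite /= opprD scalerN.
- by rewrite /= opprD scalerN opprK.
- by rewrite /= (raddfN (diff X _)).
Qed.
Definition cswap : chain_map (cmul a (cmul b X)) (cmul b (cmul a X)) :=
  @ChainMap R _ _ (fun n => linmap (@cswap_linear n)) cswap_chain.
End Swap.

Lemma diso_cswap a b X : diso (cmul a (cmul b X)) (cmul b (cmul a X)).
Proof.
apply: (@diso_cinverse _ _ (cswap a b X) (cswap b a X)).
by split=> n [[? ?] [? ?]]; rewrite /= /cswap_fun /= opprK.
Qed.

Section SuspCone.
Variables (a : R) (X : complex R).
(** Suspension commutes with the cone up to a sign on the shifted summand, because
    the differential of a suspension is negated. *)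
Definition susp_cmul_fun n (v : susp (cmul a X) n) : cmul a (susp X) n :=
  (v.1, - v.2).
Fact susp_cmul_linear n : linear (@susp_cmul_fun n).
Proof.
by move=> c u v; congr pair; rewrite /= opprD scalerN.
Qed.
Fact susp_cmul_chain n (v : susp (cmul a X) n) :
  susp_cmul_fun (diff (susp (cmul a X)) n v) =
  diff (cmul a (susp X)) n (susp_cmul_fun v).
Proof.
rewrite cmul_diff /susp_cmul_fun /= /cone_diff_fun /=; congr pair.
  by rewrite opprD scalerN.
by rewrite (raddfN (diff X _)).
Qed.
Definition susp_cmul : chain_map (susp (cmul a X)) (cmul a (susp X)) :=
  @ChainMap R _ _ (fun n => linmap (@susp_cmul_linear n)) susp_cmul_chain.

Definition cmul_susp_fun n (v : cmul a (susp X) n) : susp (cmul a X) n :=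
  (v.1, - v.2).
Fact cmul_susp_linear n : linear (@cmul_susp_fun n).
Proof.
by move=> c u v; congr pair; rewrite /= opprD scalerN.
Qed.
Fact cmul_susp_chain n (v : cmul a (susp X) n) :
  cmul_susp_fun (diff (cmul a (susp X)) n v) =
  diff (susp (cmul a X)) n (cmul_susp_fun v).
Proof.
rewrite cmul_diff /cmul_susp_fun /= /cone_diff_fun /=; congr pair.
  by rewrite opprD scalerN opprK.
by rewrite (raddfN (diff X _)).
Qed.
Definition cmul_susp : chain_map (cmul a (susp X)) (susp (cmul a X)) :=
  @ChainMap R _ _ (fun n => linmap (@cmul_susp_linear n)) cmul_susp_chain.

End SuspCone.

(** The Koszul complex on ys with coefficients in a complex B.  A variable base B
    is used instead of the sphere because inductions on ys move suspensions from
    the outside of the complex into its base (kos_susp). *)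
Definition kos (ys : seq R) B : complex R := foldr cmul B ys.

Fixpoint kos_susp (ys : seq R) B : chain_map (susp (kos ys B)) (kos ys (susp B)) :=
  match ys with
  | [::] => cid (susp B)
  | a :: ys' => ccomp (ccone a (kos_susp ys' B)) (susp_cmul a (kos ys' B))
  end.

Fixpoint susp_kos (ys : seq R) B : chain_map (kos ys (susp B)) (susp (kos ys B)) :=
  match ys with
  | [::] => cid (susp B)
  | a :: ys' => ccomp (cmul_susp a (kos ys' B)) (ccone a (susp_kos ys' B))
  end.

Lemma kos_suspK ys B : cinverse (kos_susp ys B) (susp_kos ys B).
Proof.
elim: ys => [|a ys [IH1 IH2]]; first by split.
split=> n [u p] /=; rewrite /cmul_susp_fun /ccone_fun /susp_cmul_fun /=.
  by congr pair; [apply: IH1|rewrite !raddfN opprK; apply: IH1].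
by congr pair; [apply: IH2|rewrite opprK; apply: IH2].
Qed.

(** The factors of a Koszul complex may be reordered: an innermost factor can be
    moved to the outside. *)
Lemma diso_kos_cmul ys a X : diso (kos ys (cmul a X)) (cmul a (kos ys X)).
Proof.
elim: ys => [|b ys IH] /=; first exact: diso_refl.
exact: diso_trans (diso_cmul b IH) (diso_cswap _ _ _).
Qed.

End ConeOfMultiplication.

(** * Homotopically projective complexes *)

Section HomotopyProjective.
Variable R : comPzRingType.
Implicit Types X Y Z P Q A B : complex R.

(** Lifting against arbitrary linear maps whose image contains that of f; unlike
    surjectivity of g, this is what one meets when lifting cycles that are known
    to be boundaries. *)
Definition projective (M : lmodType R) : Prop :=
  forall (U V : lmodType R) (g : {linear U -> V}) (f : {linear M -> V}),
    (forall m, exists u, g u = f m) ->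
    exists h : {linear M -> U}, forall m, g (h m) = f m.

Lemma projective_rV m : projective 'rV[R]_m.
Proof.
move=> U V g f gf.
pose u (i : 'I_m) : U := sval (boolp.cid (gf (delta_mx 0 i))).
have uP i : g (u i) = f (delta_mx 0 i) by rewrite /u; case: boolp.cid.
have h_lin : linear (fun v : 'rV[R]_m => \sum_i v 0 i *: u i).
  move=> a v w; rewrite scaler_sumr -big_split /=; apply: eq_bigr => i _.
  by rewrite !mxE scalerDl scalerA.
exists (linmap h_lin) => v /=; rewrite linear_sum [in RHS](row_sum_delta v) linear_sum.
by apply: eq_bigr => i _; rewrite !linearZ /= uP.
Qed.

(** Zero differential and projective components; such complexes play the role of
    sums of shifted projectives, spheres in particular. *)
Definition graded_projective P : Prop :=
  (forall n x, diff P n x = 0) /\ (forall n, projective (P n)).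

Lemma graded_projective_susp P : graded_projective P -> graded_projective (susp P).
Proof.
by move=> [d0 pP]; split=> n; [move=> x; rewrite /= d0 oppr0|apply: pP].
Qed.

Lemma graded_projective_sphere i : graded_projective (sphere R i).
Proof. by split=> n //; apply: projective_rV. Qed.

(** These are the complexes out of which morphisms of the derived category can be
    computed as homotopy classes of chain maps. *)
Definition Kprojective P : Prop :=
  forall A, acyclic A -> forall c : chain_map P A, nullhomotopic (fun n => c n).

Lemma nullhomotopic_boundaries P Y (c : chain_map P Y) : graded_projective P ->
  (forall n x, boundary (c (prevz n) x)) -> nullhomotopic (fun n => c n).
Proof.
move=> [d0 pP] bc.
have H n : exists h : {linear P (prevz n) -> Y n}, forall x, diff Y n (h x) = c _ x.
  by apply: pP => x; have [w dw] := bc n x; exists w.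
exists (fun n => sval (boolp.cid (H n))) => n x.
by rewrite d0 raddf0 addr0; case: boolp.cid.
Qed.

Lemma Kprojective_graded P : graded_projective P -> Kprojective P.
Proof.
move=> gP A acA c; apply: nullhomotopic_boundaries => // n x; apply: acA.
by rewrite /cycle -cmapP (proj1 gP) raddf0.
Qed.

Lemma Kprojective_cinverse P Q (f : chain_map P Q) (g : chain_map Q P) :
  cinverse f g -> Kprojective P -> Kprojective Q.
Proof.
move=> [_ fg] KP A acA c.
have /(nullhomotopic_compr g) := KP A acA (ccomp c f).
by apply: nullhomotopic_ext => n x /=; rewrite fg.
Qed.

(** A null homotopy on a cone is built from one on the base P and one, on the
    suspension of P, of the defect that remains after subtracting the first. *)
Lemma Kprojective_cmul a P :
  Kprojective P -> Kprojective (susp P) -> Kprojective (cmul a P).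
Proof.
move=> KP KsP A acA c.
have [h hP] := KP A acA (ccomp c (cone_in (cscale P a))).
(* The restriction of c - (d h + h d) to the shifted summand. *)
pose g n (p : susp P n) : A n := c n (0, p) - a *: h n p.
have g_lin n : linear (@g n).
  move=> b u v; rewrite /g.
  have -> : (0, b *: u + v) = b *: ((0, u) : cmul a P n) + (0, v).
    by congr pair; rewrite /= scaler0 addr0.
  rewrite (linearP (c n)) (linearP (h n)) /= scalerDr scalerBr opprD addrACA.
  by rewrite !scalerA mulrC.
have g_chain n (p : susp P n) : g (prevz n) (diff (susp P) n p) = diff A n (g n p).
  have E1 : c _ (0, diff (susp P) n p) = diff A n (c n (0, p)) - c _ (a *: p, 0).
    rewrite -cmapP cmul_diff /= raddf0 add0r -raddfB; congr (c _ _).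
    by congr pair; rewrite /= ?subrr ?subr0.
  have E2 : c _ (a *: p, 0) = a *: diff A n (h n p) + a *: h (prevz n) (diff P (prevz n) p).
    by rewrite -scalerDr -hP -linearZ.
  rewrite /g [in LHS]E1 E2 /= raddfN /= scalerN opprK raddfB /= linearZ /=.
  by rewrite opprD addrA subrK.
have [k kP] := KsP A acA (@ChainMap R _ _ (fun n => linmap (@g_lin n)) g_chain).
pose H n (v : cmul a P (prevz n)) : A n := h n v.1 + k n v.2.
have H_lin n : linear (@H n).
  by move=> b u v; rewrite /H !linearP /= scalerDr addrACA.
exists (fun n => linmap (@H_lin n)) => n [u p].
have -> : c (prevz n) (u, p) = c _ (u, 0) + c _ (0, p).
  by rewrite -raddfD; congr (c _ _); congr pair; rewrite /= ?addr0 ?add0r.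
have := hP n u; rewrite /= /cone_in_fun => ->.
have := kP n p; rewrite /= /g => /eqP; rewrite subr_eq => /eqP ->.
rewrite /H /= !linearD /= linearZ /= -(addrA (diff A n (k n p))) addrACA.
by congr (_ + _); rewrite addrA addrAC.
Qed.

(** Induction on ys needs the suspension of the smaller Koszul complex to be
    K-projective; it is the Koszul complex on a suspended base. *)
Lemma Kprojective_kos ys B : graded_projective B -> Kprojective (kos ys B).
Proof.
elim: ys B => [|a ys IH] B gB /=; first exact: Kprojective_graded.
apply: Kprojective_cmul; first exact: IH.
have [E1 E2] := kos_suspK ys B.
apply: (@Kprojective_cinverse (kos ys (susp B)) _ (susp_kos ys B) (kos_susp ys B)) => //.
exact/IH/graded_projective_susp.
Qed.

Lemma Kprojective_susp_kos ys B :
  graded_projective B -> Kprojective (susp (kos ys B)).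
Proof.
move=> gB; have [E1 E2] := kos_suspK ys B.
apply: (@Kprojective_cinverse (kos ys (susp B)) _ (susp_kos ys B) (kos_susp ys B)) => //.
exact/Kprojective_kos/graded_projective_susp.
Qed.

Lemma acyclic_cone X Y (s : chain_map X Y) : quasi_iso s -> acyclic (cone s).
Proof.
move=> qs n [y x]; rewrite /cycle /= /cone_diff_fun /= => -[] dy /eqP.
rewrite oppr_eq0 => /eqP dx.
have [injn surjn] := qs n; have [inj' _] := qs (prevz n).
have [w dw] : boundary x.
  apply: inj' => //; exists (- y); rewrite raddfN /=.
  by apply/eqP; rewrite -subr_eq0 -opprD dy oppr0.
have [z cz [v dv]] : exists2 z, cycle z & boundary (y + s _ w - s _ z).
  by apply: surjn; rewrite /cycle raddfD /= -cmapP dw dy.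
exists (v, z - w); rewrite /= /cone_diff_fun /= dv; congr pair => /=.
  by rewrite raddfB addrA subrK addrK.
by rewrite raddfB /= cz dw sub0r opprK.
Qed.

Section Lifting.
Variables (P X Y : complex R) (s : chain_map X Y).
Hypothesis qs : quasi_iso s.

(** Composed with the inclusion into the acyclic cone of s, the map c becomes null.
    The X-component of the null homotopy is a chain map lifting c, and its
    Y-component is the homotopy between the composite and c. *)
Lemma homotopy_lift : Kprojective P ->
  forall c : chain_map P Y, exists c' : chain_map P X, homotopic (ccomp s c') c.
Proof.
move=> KP c.
have [H HP] := KP _ (acyclic_cone qs) (ccomp (cone_in s) c).
pose h n p : Y n := (H n p).1; pose b n p : X (prevz n) := (H n p).2.
have h_lin n : linear (@h n) by move=> a u v; rewrite /h linearP.
have b_lin n : linear (@b n) by move=> a u v; rewrite /b linearP.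
have b_chain n p : b (prevz n) (diff P (prevz n) p) = diff X (prevz n) (b n p).
  have := congr1 snd (HP n p); rewrite /= => /esym/eqP.
  by rewrite addrC subr_eq0 => /eqP.
pose c' := @unprev (fun m => {linear P m -> X m}) (fun n => linmap (@b_lin n)).
have c'E n : c' (prevz n) = linmap (@b_lin n) by apply: unprevE.
have c'_chain n x : c' (prevz n) (diff P n x) = diff X n (c' n x).
  by elim/prevz_ind: n x => n x; rewrite !c'E /= b_chain.
exists (@ChainMap R _ _ c' c'_chain).
exists (fun n => (\- linmap (@h_lin n))%FUN) => n p.
have := congr1 fst (HP n p); rewrite /= c'E /= => ->.
rewrite -/(h n p) -/(b n p) -/(h (prevz n) _) raddfN (addrAC (diff Y n _)) opprD.
by rewrite [LHS]addrC subrK opprD.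
Qed.

(** A homotopy h from s c to s c', together with the difference c' - c, is a chain
    map from the suspension of P to the acyclic cone of s; it is null, and the
    X-component of its null homotopy joins c to c'. *)
Lemma homotopy_cancel : Kprojective (susp P) -> forall c c' : chain_map P X,
  homotopic (ccomp s c) (ccomp s c') -> homotopic c c'.
Proof.
move=> KsP c c' [h hP].
pose F n (p : susp P n) : cone s n := (h n p, c' (prevz n) p - c (prevz n) p).
have F_lin n : linear (@F n).
  move=> a u v; congr pair => /=; first by rewrite linearP.
  by rewrite (linearP (c _)) (linearP (c' _)) scalerBr opprD addrACA.
have F_chain n (p : susp P n) : F _ (diff (susp P) n p) = diff (cone s) n (F n p).
  rewrite /F /= /cone_diff_fun /=; congr pair => /=.
    rewrite raddfN raddfB /=; apply/eqP; rewrite eq_sym -addr_eq0 addrAC.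
    by rewrite -[X in X + _](hP n p) /= addrA subrK subrr.
  by rewrite (raddfN (c _)) (raddfN (c' _)) raddfB /= !cmapP opprB opprK addrC.
have [K KP] := KsP _ (acyclic_cone qs) (@ChainMap R _ _ (fun n => linmap (@F_lin n)) F_chain).
pose l n (p : P (prevz (prevz n))) : X (prevz n) := (K n p).2.
have l_lin n : linear (@l n) by move=> a u v; rewrite /l linearP.
pose l' := @unprev (fun m => {linear P (prevz m) -> X m}) (fun n => linmap (@l_lin n)).
have l'E n : l' (prevz n) = linmap (@l_lin n) by apply: unprevE.
exists l' => n x; elim/prevz_ind: n x => n p; rewrite !l'E /=.
have := congr1 snd (KP n p); rewrite /= => /(congr1 -%R); rewrite opprB => ->.
by rewrite opprD opprK raddfN /= opprK.
Qed.

End Lifting.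

(** The graph of the map that a morphism f of the derived category induces on
    homotopy classes of chain maps out of P.  A relation avoids choosing lifts
    through the inverted quasi-isomorphisms. *)
Fixpoint hrel P X Y (f : dmap X Y) : chain_map P X -> chain_map P Y -> Prop :=
  match f with
  | dmap_of _ _ f => fun a b => homotopic (ccomp f a) b
  | dmap_inv _ _ s _ => fun a b => homotopic (ccomp s b) a
  | dcomp _ _ _ g f => fun a c => exists2 b, hrel f a b & hrel g b c
  end.

Lemma hrel_homotopicl P X Y (f : dmap X Y) (a a' : chain_map P X) b :
  homotopic a a' -> hrel f a b -> hrel f a' b.
Proof.
elim: f a a' b => {X Y} /=.
- move=> X Y f a a' b aa'; apply: homotopic_trans; apply: homotopic_compl.
  exact: homotopic_sym.
- by move=> X Y s qs a a' b aa' sb; apply: homotopic_trans sb aa'.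
- by move=> X Y Z g _ f IH a a' c aa' [b ab bc]; exists b => //; apply: IH ab.
Qed.

Lemma hrel_homotopicr P X Y (f : dmap X Y) (a : chain_map P X) b b' :
  homotopic b b' -> hrel f a b -> hrel f a b'.
Proof.
elim: f a b b' => {X Y} /=.
- by move=> X Y f a b b' bb' fa; apply: homotopic_trans fa bb'.
- move=> X Y s qs a b b' bb'; apply: homotopic_trans; apply: homotopic_compl.
  exact: homotopic_sym.
- by move=> X Y Z g IH f _ a b b' bb' [c ac cb]; exists c => //; apply: IH cb.
Qed.

(** For K-projective P, postcomposition with a quasi-isomorphism is bijective on
    homotopy classes, so that the functor of homotopy classes out of P factors
    through the localization.  Injectivity is used for the left inverse law and
    surjectivity for the right inverse law. *)
Lemma hrel_deq P X Y (f g : dmap X Y) : Kprojective P -> Kprojective (susp P) ->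
  deq f g -> forall a b, @hrel P X Y f a b <-> hrel g a b.
Proof.
move=> KP KsP.
have Ec Y' (b : chain_map P Y') : homotopic (ccomp (Defs.cid Y') b) b.
  exact: homotopic_refl.
elim=> {X Y f g} /=.
- by [].
- by move=> X Y f g _ IH a b; split=> /IH.
- by move=> X Y f g h _ IH1 _ IH2 a b; split=> [/IH1/IH2|/IH2/IH1].
- move=> X Y Z g g' f f' _ IH1 _ IH2 a c.
  by split=> -[b /IH2 ab /IH1 bc]; exists b.
- move=> X Y Z W h g f a d; split.
    by move=> [c [b ab bc] cd]; exists b => //; exists c.
  by move=> [b ab [c bc cd]]; exists c => //; exists b.
- move=> X Y f a b; split.
    move=> [b' ab' b'b]; apply: hrel_homotopicr ab'.
    by apply: homotopic_trans b'b; apply/homotopic_sym/Ec.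
  by move=> ab; exists b.
- move=> X Y f a b; split.
    move=> [a' aa' a'b]; apply: hrel_homotopicl a'b.
    by apply: homotopic_trans (homotopic_sym aa') (Ec _ _).
  by move=> ab; exists a.
- move=> X Y f g fg a b.
  have fga : homotopic (ccomp f a) (ccomp g a).
    by apply: nullhomotopic_ext (nullhomotopic0 _ _) => n x; rewrite /= fg subrr.
  split; apply: homotopic_trans => //; exact: homotopic_sym.
- move=> X Y Z g f a c.
  have gfa : homotopic (ccomp (ccomp g f) a) (ccomp g (ccomp f a)).
    exact: homotopic_refl.
  split=> [gfac|[b fab gbc]].
    by exists (ccomp f a); [apply: homotopic_refl|].
  apply: homotopic_trans gfa _; apply: homotopic_trans gbc.
  exact: homotopic_compl.
- move=> X Y s qs a c; split.
    move=> [b sab scb]; apply: homotopic_trans (Ec _ _) _.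
    apply: (homotopy_cancel qs) => //.
    exact: homotopic_trans sab (homotopic_sym scb).
  move=> ac; exists (ccomp s a); first exact: homotopic_refl.
  apply: homotopic_compl; apply: homotopic_sym.
  by apply: homotopic_trans ac; apply/homotopic_sym/Ec.
move=> X Y s qs a c; split.
  move=> [b sba sbc]; apply: homotopic_trans (Ec _ _) _.
  exact: homotopic_trans (homotopic_sym sba) sbc.
move=> ac; have [b sba] := homotopy_lift qs KP a.
exists b => //; apply: homotopic_trans sba _.
by apply: homotopic_trans ac; apply/homotopic_sym/Ec.
Qed.

(** The functor of homotopy classes out of P, evaluated at the class of the
    identity of P, separates chain maps out of P up to homotopy. *)
Lemma deq_homotopic P X (f g : chain_map P X) :
  Kprojective P -> Kprojective (susp P) ->
  deq (dmap_of f) (dmap_of g) -> homotopic f g.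
Proof.
move=> KP KsP fg.
have /(hrel_deq KP KsP fg (Defs.cid P) f) gf : hrel (dmap_of f) (Defs.cid P) f.
  exact: homotopic_refl.
exact: homotopic_sym gf.
Qed.

Lemma hrel_total P X Y (f : dmap X Y) (a : chain_map P X) :
  Kprojective P -> exists b, hrel f a b.
Proof.
move=> KP; elim: f a => {X Y} /=.
- by move=> X Y f a; exists (ccomp f a); apply: homotopic_refl.
- by move=> X Y s qs a; have [b] := homotopy_lift qs KP a; exists b.
- by move=> X Y Z g IHg f IHf a; have [b ab] := IHf a; have [c bc] := IHg b; exists c, b.
Qed.

(** Together with hrel_total, this represents every morphism of the derived
    category out of a K-projective complex by a chain map. *)
Lemma hrel_dcomp P X Y (f : dmap X Y) (a : chain_map P X) b :
  hrel f a b -> deq (dcomp f (dmap_of a)) (dmap_of b).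
Proof.
elim: f a b => {X Y} /=.
- move=> X Y f a b /homotopic_deq; apply: deq_trans.
  exact/deq_sym/deq_of_comp.
- move=> X Y s qs a b /homotopic_deq sb.
  apply: deq_trans (deq_compl _ (deq_sym sb)) _.
  apply: deq_trans (deq_compl _ (deq_of_comp _ _)) _.
  apply: deq_trans (deq_assoc _ _ _) _.
  exact: deq_trans (deq_compr _ (deq_invl _)) (deq_idl _).
- move=> X Y Z g IHg f IHf a c [b /IHf ab /IHg bc].
  apply: deq_trans bc; apply: deq_trans (deq_compl _ ab).
  exact/deq_sym/deq_assoc.
Qed.

Lemma Kprojective_dmap P X (f : dmap P X) :
  Kprojective P -> exists c : chain_map P X, deq f (dmap_of c).
Proof.
move=> KP; have [c fc] := hrel_total f (Defs.cid P) KP.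
by exists c; apply: deq_trans (hrel_dcomp fc); apply/deq_sym/deq_idr.
Qed.

End HomotopyProjective.

(** * The top cell of a Koszul complex *)

Section TopCell.
Variable R : comPzRingType.
Implicit Types X Y Z P Q A B : complex R.

Lemma deq_dzero X Y (f : chain_map X Y) :
  nullhomotopic (fun n => f n) -> deq (dmap_of f) (dzero X Y).
Proof.
by move=> f0; apply: homotopic_deq; apply: nullhomotopic_ext f0 => n x; rewrite /= subr0.
Qed.

Lemma dzero_nullhomotopic P Y (f : chain_map P Y) :
  Kprojective P -> Kprojective (susp P) ->
  deq (dmap_of f) (dzero P Y) -> nullhomotopic (fun n => f n).
Proof.
move=> KP KsP /(deq_homotopic KP KsP); apply: nullhomotopic_ext => n x /=.
by rewrite subr0.
Qed.

(** Maps from spheres are represented by chain maps, that is by cycles; a cycle sent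
    to a boundary gives a map that is null because the sphere is free. *)
Lemma pi_eq0_boundaries X Y (f : chain_map X Y) :
  (forall n (z : X (prevz n)), cycle z -> boundary (f _ z)) -> pi_eq0 (dmap_of f).
Proof.
move=> bf i a.
have gS := graded_projective_sphere R i.
have [c ac] := Kprojective_dmap a (Kprojective_graded gS).
apply: deq_trans (deq_compl _ ac) _; apply: deq_trans (deq_sym (deq_of_comp _ _)) _.
apply/deq_dzero/nullhomotopic_boundaries => // n x /=.
by apply: bf; rewrite /cycle -cmapP raddf0.
Qed.

Lemma nullhomotopic_boundary Q Y (g : chain_map Q Y) :
  (forall n x, diff Q n x = 0) -> nullhomotopic (fun n => g n) ->
  forall n x, boundary (g (prevz n) x).
Proof. by move=> d0 [h hP] n x; exists (h n x); rewrite hP d0 raddf0 addr0. Qed.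

(** The triangle X -a-> X -> cone -> susp X shows that a map g from susp X to Y
    vanishing on the cone factors through a : susp X -> susp X, hence through
    a : Y -> Y, which is null.  Here h1 is the factor and h2 the homotopy. *)
Lemma nullhomotopic_cone_out a X Y (g : chain_map (susp X) Y) :
  nullhomotopic (fun n (y : Y n) => a *: y) ->
  nullhomotopic (fun n (v : cmul a X n) => g n (cone_out (cscale X a) n v)) ->
  nullhomotopic (fun n => g n).
Proof.
move=> Ya [h hP].
pose h1 n (u : susp X n) : Y n := h n (u, 0).
pose h2 n (p : susp X (prevz n)) : Y n := h n (0, p).
have h1_lin n : linear (@h1 n).
  move=> b u v; rewrite /h1 -linearP; congr (h n _).
  by congr pair; rewrite /= scaler0 addr0.
have h2_lin n : linear (@h2 n).
  move=> b u v; rewrite /h2 -linearP; congr (h n _).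
  by congr pair; rewrite /= scaler0 addr0.
have h1_chain n u : h1 (prevz n) (diff (susp X) n u) = diff Y n (h1 n u).
  have := hP n (u, 0); rewrite /= /cone_out_fun /= !raddf0 => /esym/eqP.
  rewrite addrC addr_eq0 => /eqP E; apply: oppr_inj; rewrite -E /h1 -raddfN.
  congr (h _ _); rewrite /cone_diff_fun /=; congr pair => /=.
    by rewrite scaler0 addr0 opprK.
  by rewrite (raddf0 (diff _ _)).
have := nullhomotopic_compr (@ChainMap R _ _ (fun n => linmap (@h1_lin n)) h1_chain) Ya.
have h2N : nullhomotopic (fun n (p : susp X n) => g n p - a *: h1 n p).
  exists (fun n => linmap (@h2_lin n)) => n p /=.
  have := hP n (0, p); rewrite /= /cone_out_fun /= => ->.
  rewrite -addrA; congr (_ + _); rewrite /h1 /h2 -linearZ /= -raddfB; congr (h _ _).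
  rewrite /cone_diff_fun /=; congr pair => /=.
    by rewrite raddf0 add0r subrr.
  by rewrite scaler0 subr0.
move/(nullhomotopicD h2N); apply: nullhomotopic_ext => n x.
by rewrite /= subrK.
Qed.

(** The suspensions accumulate on the base, which matches the recursion that
    defines kos_top. *)
Fixpoint sus (n : nat) B : complex R := if n is n'.+1 then sus n' (susp B) else B.

Fixpoint csus (n : nat) X Y (f : chain_map X Y) : chain_map (sus n X) (sus n Y) :=
  if n is n'.+1 return chain_map (sus n X) (sus n Y) then csus n' (csusp f) else f.

(** The projection of the Koszul complex onto its top cell. *)
Fixpoint kos_top (ys : seq R) B : chain_map (kos ys B) (sus (size ys) B) :=
  match ys with
  | [::] => Defs.cid B
  | a :: ys' => ccomp (kos_top ys' (susp B))
                  (ccomp (kos_susp ys' B) (cone_out (cscale (kos ys' B) a)))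
  end.

(** The inclusion of the bottom cell. *)
Fixpoint kos_unit (ys : seq R) B : chain_map B (kos ys B) :=
  match ys with
  | [::] => Defs.cid B
  | a :: ys' => ccomp (cone_in (cscale (kos ys' B) a)) (kos_unit ys' B)
  end.

Lemma graded_projective_sus n B : graded_projective B -> graded_projective (sus n B).
Proof. by elim: n B => //= n IH B /graded_projective_susp/IH. Qed.

(** On cmul a X the homotopy (u, p) |-> (0, u) contracts multiplication by a, and a
    contraction on X extends to the cone with a sign on the shifted summand. *)
Lemma kos_scale_null ys B y :
  y \in ys -> nullhomotopic (fun n (v : kos ys B n) => y *: v).
Proof.
elim: ys => // a ys IH; rewrite inE => /orP[/eqP ->|/IH [h hP]].
  pose h n (v : cmul a (kos ys B) (prevz n)) : cmul a (kos ys B) n := (0, v.1).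
  have h_lin n : linear (@h n).
    by move=> b u v; rewrite /h; congr pair; rewrite /= scaler0 addr0.
  exists (fun n => linmap (@h_lin n)) => n [u p] /=.
  rewrite /cone_diff_fun /h /=; congr pair => /=.
    by rewrite raddf0 add0r addr0.
  by rewrite addKr.
pose H n (v : cmul a (kos ys B) (prevz n)) : cmul a (kos ys B) n :=
  (h n v.1, - h (prevz n) v.2).
have H_lin n : linear (@H n).
  move=> b u v; rewrite /H; congr pair; rewrite /= linearP //.
  by rewrite scalerN opprD.
exists (fun n => linmap (@H_lin n)) => n [u p] /=.
rewrite /cone_diff_fun /H /=; congr pair => /=; rewrite hP.
  by rewrite raddfD /= linearZ /= scalerN addrACA addNr addr0.
by rewrite (raddfN (diff _ _)) (raddfN (h _)) !opprK.
Qed.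

Lemma sus_scale_null n Y y : nullhomotopic (fun n (v : Y n) => y *: v) ->
  nullhomotopic (fun m (v : sus n Y m) => y *: v).
Proof.
elim: n Y => //= n IH Y [h hP]; apply: IH.
exists (fun m => (\- h (prevz m))%FUN) => m v /=.
by rewrite hP (raddfN (diff _ _)) (raddfN (h _)) !opprK.
Qed.

(** A cycle (u, q) of cmul a X has a q = - d u, so that a kills the class of q, and
    the top cell has zero differential. *)
Lemma kos_top_cycle ys B n (v : kos ys B n) : (forall n x, diff B n x = 0) ->
  diff (kos ys B) n v = 0 -> forall y, y \in ys -> y *: kos_top ys B n v = 0.
Proof.
elim: ys B n v => // a ys IH B n v dB.
elim/prevz_ind: n v => n [u q]; rewrite cmul_diff /= => -[] du dq y.
have dsB m x : diff (susp B) m x = 0 by rewrite /= dB oppr0.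
have cq : diff (kos ys (susp B)) (prevz n) (kos_susp ys B (prevz n) q) = 0.
  by rewrite -cmapP /= dq raddf0.
rewrite inE => /orP[/eqP ->|/IH]; last by apply.
rewrite -linearZ -linearZ /=.
(* The suspension negates the differential, which absorbs the sign. *)
have -> : a *: q = diff (susp (kos ys B)) n u.
  by apply/eqP; rewrite /= -addr_eq0 addrC du.
rewrite !cmapP.
have d0 m k C x : (forall m x, diff C m x = 0) -> diff (sus k C) m x = 0.
  elim: k C x => [|k IHk] C x dC; first exact: dC.
  by apply: IHk => m' x' /=; rewrite dC oppr0.
exact: d0.
Qed.

(** If every element of ys acts as zero on Y, precomposition with the top cell
    projection is injective up to homotopy, since each of the cones that build
    the Koszul complex contributes a split injection. *)
Lemma kos_top_null ys B Y (g : chain_map (sus (size ys) B) Y) :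
  (forall y, y \in ys -> nullhomotopic (fun n (v : Y n) => y *: v)) ->
  nullhomotopic (fun n (v : kos ys B n) => g n (kos_top ys B n v)) ->
  nullhomotopic (fun n => g n).
Proof.
elim: ys B g => //= a ys IH B g Yys g0.
have Yys' y : y \in ys -> nullhomotopic (fun n (v : Y n) => y *: v).
  by move=> yys; apply: Yys; rewrite inE yys orbT.
apply: (IH (susp B) g) => //.
have [_ sK] := kos_suspK ys B.
have Ya : nullhomotopic (fun n (v : Y n) => a *: v) by apply: Yys; rewrite inE eqxx.
have := @nullhomotopic_cone_out a (kos ys B) Y
  (ccomp g (ccomp (kos_top ys (susp B)) (kos_susp ys B))) Ya g0.
move/(nullhomotopic_compr (susp_kos ys B)); apply: nullhomotopic_ext => n x /=.
by rewrite sK.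
Qed.

(** For Q a suspension of the sphere, this says that g kills the elements of the
    annihilator of ys up to boundaries, which are the only ones that come from
    cycles of the Koszul complex through kos_top. *)
Definition ann_boundary (ys : seq R) Q Y (g : chain_map Q Y) : Prop :=
  forall n (u : Q (prevz n)), (forall y, y \in ys -> y *: u = 0) -> boundary (g _ u).

Definition all_boundary Q Y (g : chain_map Q Y) : Prop :=
  forall n (u : Q (prevz n)), boundary (g _ u).

(** The only consequence of the generating hypothesis that the forward direction
    uses.  The composite of g with the top cell projection kills homotopy, by
    kos_top_cycle and the assumption on g, hence is zero, and then g itself is
    null by kos_top_null. *)
Lemma GH_kos_top (C : complex R -> Prop) ys B Y (g : chain_map (sus (size ys) B) Y) :
  GH C -> graded_projective B -> C (kos ys B) -> C Y ->
  (forall y, y \in ys -> nullhomotopic (fun n (v : Y n) => y *: v)) ->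
  ann_boundary ys g -> all_boundary g.
Proof.
move=> ghC gB CB CY Yys gb.
have KP := @Kprojective_kos _ ys B gB; have KsP := @Kprojective_susp_kos _ ys B gB.
have f0 : deq (dmap_of (ccomp g (kos_top ys B))) (dzero _ _).
  apply: ghC => //; apply: pi_eq0_boundaries => n z cz /=.
  by apply: gb => y; apply: kos_top_cycle => //; case: gB.
apply: nullhomotopic_boundary; first by case: (graded_projective_sus (size ys) gB).
by apply: (kos_top_null Yys); apply: dzero_nullhomotopic f0.
Qed.

Lemma ann_boundary_csus ys n Q Y (g : chain_map Q Y) :
  ann_boundary ys g -> ann_boundary ys (csus n g).
Proof.
elim: n Q Y g => //= n IH Q Y g gb; apply: IH => m u /gb[w dw].
by exists (- w); rewrite /= raddfN opprK.
Qed.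

Lemma all_boundary_csus n Q Y (g : chain_map Q Y) :
  all_boundary (csus n g) -> all_boundary g.
Proof.
elim: n Q Y g => //= n IH Q Y g /IH gb; elim/prevz_ind => m u.
by have [w /= dw] := gb m u; exists (- w); rewrite raddfN.
Qed.

End TopCell.

(** * Annihilators under the generating hypothesis *)

Section Annihilators.
Variable R : comPzRingType.
Implicit Types (ys : seq R) (B Y : complex R) (C : complex R -> Prop).

Lemma ideal_cons a ys r :
  r \in ideal (a :: ys) <-> exists b, r - b * a \in ideal ys.
Proof.
split=> [/idealP[c ->]|[b /idealP[c E]]].
  exists (c ord0); rewrite big_ord_recl /= addrC addKr.
  by apply/idealP; exists (fun i => c (lift ord0 i)).
apply/idealP; exists (fun i => if unlift ord0 i is Some j then c j else b).
rewrite big_ord_recl /= unlift_none -[LHS](subrK (b * a)) E addrC.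
by congr (_ + _); apply: eq_bigr => i _; rewrite liftK.
Qed.

Lemma ideal_behead a ys r : r \in ideal ys -> r \in ideal (a :: ys).
Proof. by move=> ri; apply/ideal_cons; exists 0; rewrite mul0r subr0. Qed.

Lemma ideal_mem ys y : y \in ys -> y \in ideal ys.
Proof.
elim: ys => // a ys IH; rewrite inE => /orP[/eqP ->|/IH]; last exact: ideal_behead.
by apply/ideal_cons; exists 1; rewrite mul1r subrr rpred0.
Qed.

Lemma ideal_sub ys zs : {subset ys <= ideal zs} -> {subset ideal ys <= ideal zs}.
Proof.
move=> sub r /idealP[c ->]; apply: rpred_sum => i _; apply: idealMr.
exact/sub/mem_nth.
Qed.

Definition annihilates ys (r : R) : Prop := forall y, y \in ys -> y * r = 0.

Lemma ideal_ann ys a r : a \in ideal ys -> annihilates ys r -> a * r = 0.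
Proof.
move=> /idealP[c ->] yr; rewrite mulr_suml big1 // => i _.
by rewrite -mulrA yr ?mulr0 // mem_nth.
Qed.

Lemma kos_ideal_boundary ys B n (z : kos ys B (prevz n)) a :
  a \in ideal ys -> cycle z -> boundary (a *: z).
Proof.
move=> /idealP[c ->] cz.
have H (i : 'I_(size ys)) : boundary ((c i * ys`_i) *: z).
  have [h hP] := @kos_scale_null _ ys B ys`_i (mem_nth _ (ltn_ord i)).
  by exists (c i *: h n z); rewrite linearZ /= -scalerA hP cz raddf0 addr0.
rewrite scaler_suml; elim/big_ind: _ => //; first by exists 0; rewrite raddf0.
by move=> x y [u <-] [v <-]; exists (u + v); rewrite raddfD.
Qed.

(** The projection onto the bottom cell.  It is not a chain map, but it sends
    boundaries into the ideal times the base (kos_aug_diff), which detects the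
    ideal on the bottom homology. *)
Fixpoint kos_aug ys B n : kos ys B n -> B n :=
  match ys with
  | [::] => id
  | a :: ys' => fun v => kos_aug v.1
  end.

Lemma kos_aug_linear ys B n : linear (@kos_aug ys B n).
Proof. by elim: ys => //= a ys IH b u v; rewrite IH. Qed.

Lemma kos_aug_unit ys B n x : kos_aug (kos_unit ys B n x) = x.
Proof. by elim: ys. Qed.

Lemma kos_aug_diff ys i n (v : kos ys (sphere R i) n) k :
  kos_aug (diff (kos ys (sphere R i)) n v) 0 k \in ideal ys.
Proof.
elim: ys v => [|a ys IH] v /=; first by rewrite mxE rpred0.
have -> : kos_aug (diff (kos ys (sphere R i)) n v.1 + a *: v.2) =
    a *: kos_aug v.2 + kos_aug (diff (kos ys (sphere R i)) n v.1).
  by rewrite addrC kos_aug_linear.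
rewrite !mxE; apply: rpredD; last exact/ideal_behead/IH.
by rewrite mulrC; apply/idealMr/ideal_mem; rewrite inE eqxx.
Qed.

(** GH_kos_top applied to c times the bottom cell: its class in R / I is killed by
    the annihilator of I, so it vanishes.  The suspension of the Koszul complex
    puts its bottom cell in the degree of the top cell. *)
Lemma GH_ideal_ann C ys c : GH C ->
  C (kos ys (sphere R 0)) -> C (sus (size ys) (kos ys (sphere R 0))) ->
  (forall r, annihilates ys r -> c * r \in ideal ys) -> c \in ideal ys.
Proof.
move=> ghC CK CsK cann.
pose g := ccomp (kos_unit ys (sphere R 0)) (cscale (sphere R 0) c).
have gb : ann_boundary ys g.
  move=> n u yu; rewrite [u]row_sum_delta linear_sum /=.
  elim/big_ind: _ => //; first by exists 0; rewrite raddf0.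
    by move=> x y [v <-] [w <-]; exists (v + w); rewrite raddfD.
  move=> k _; rewrite -[kos_unit _ _ _ _]/(kos_unit ys _ _ (c *: _)) scalerA linearZ /=.
  apply: kos_ideal_boundary; last first.
    by rewrite /cycle -(cmapP (kos_unit ys (sphere R 0))) /= raddf0.
  by apply: cann => y /yu /matrixP/(_ 0 k); rewrite !mxE.
have Ksn y : y \in ys -> nullhomotopic
    (fun n (v : sus (size ys) (kos ys (sphere R 0)) n) => y *: v).
  by move=> yys; apply/sus_scale_null/kos_scale_null.
have {}gb : all_boundary g.
  apply: (@all_boundary_csus _ (size ys)).
  apply: (GH_kos_top ghC (graded_projective_sphere R 0) CK CsK Ksn).
  exact: ann_boundary_csus.
have ci n (u : sphere R 0 n) k : (c *: u) 0 k \in ideal ys.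
  elim/prevz_ind: n u k => n u k; have [v dv] := gb n u.
  have := kos_aug_diff v k.
  by rewrite dv /= kos_aug_unit.
by have := ci 0 (const_mx 1) ord0; rewrite !mxE mulr1.
Qed.

(** The inclusion of the top cell is not a chain map, but its multiple by an
    element w that annihilates ys is one.  The last two conclusions record that g
    is w times a linear map, which the induction on ys relies on. *)
Lemma top_class_multiple ys B w : annihilates ys w ->
  exists g : chain_map (sus (size ys) B) (kos ys B),
    [/\ forall n u, kos_top ys B n (g n u) = w *: u,
        forall b, b * w = 0 -> forall n u, b *: g n u = 0
      & forall n u, w *: u = 0 -> g n u = 0].
Proof.
elim: ys B => [|a ys IH] B yw.
  exists (cscale B w); split=> //= b bw n u.
  by rewrite /= scalerA bw scale0r.
have [|g' [gtop gb gw]] := IH (susp B); first by move=> y yys; apply: yw; rewrite inE yys orbT.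
pose g n (u : sus (size ys) (susp B) n) : kos (a :: ys) B n := (0, susp_kos ys B n (g' n u)).
have g_lin n : linear (@g n).
  move=> b u v; congr pair; first by rewrite /= scaler0 addr0.
  by rewrite /= !linearP.
have g_chain n u : g (prevz n) (diff _ n u) = diff (kos (a :: ys) B) n (g n u).
  congr pair => /=.
    rewrite raddf0 add0r -linearZ /= gb ?raddf0 //.
    by apply: yw; rewrite inE eqxx.
  by rewrite !cmapP.
exists (@ChainMap R _ (kos (a :: ys) B) (fun n => linmap (@g_lin n)) g_chain).
have [_ sK] := kos_suspK ys B.
split=> [n u|b bw n u|n u wu] /=.
- by rewrite /cone_out_fun /= sK gtop.
- rewrite /g; congr pair => /=; first by rewrite scaler0.
  by rewrite -linearZ /= gb // raddf0.
- by rewrite /g gw // raddf0.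
Qed.

(** GH_kos_top applied to w times the top cell.  In particular the ideal of ys
    meets its annihilator trivially, as any element w of both satisfies the
    assumption. *)
Lemma GH_ann_nil C ys w : GH C -> C (kos ys (sphere R 0)) ->
  annihilates ys w -> (forall r, annihilates ys r -> w * r = 0) -> w = 0.
Proof.
move=> ghC CK yw wann.
have [g [gtop _ gw]] := top_class_multiple (sphere R 0) yw.
have wS k m (u : sus k (sphere R 0) m) : (forall y, y \in ys -> y *: u = 0) -> w *: u = 0.
  have : forall m (u : sphere R 0 m), (forall y, y \in ys -> y *: u = 0) -> w *: u = 0.
    move=> {}m {}u yu; apply/rowP => i; rewrite !mxE; apply: wann => y /yu.
    by move=> /matrixP/(_ 0 i); rewrite !mxE.
  elim: k (sphere R 0) m u => [|k IH] B m u H; first exact: H.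
  by apply: IH => m' u'; apply: H.
have gb : ann_boundary ys g.
  by move=> n u /wS/gw ->; exists 0; rewrite raddf0.
have Kn y : y \in ys -> nullhomotopic (fun n (v : kos ys (sphere R 0) n) => y *: v).
  by move=> yys; apply: kos_scale_null.
have {}gb : all_boundary g.
  exact: (GH_kos_top ghC (graded_projective_sphere R 0) CK CK Kn gb).
have w0 n (u : sus (size ys) (sphere R 0) n) : w *: u = 0.
  elim/prevz_ind: n u => n u; have [v dv] := gb n u.
  rewrite -gtop -dv cmapP.
  by have [-> //] := graded_projective_sus (size ys) (graded_projective_sphere R 0).
have {}w0 : forall n (u : sphere R 0 n), w *: u = 0.
  elim: (size ys) (sphere R 0) w0 => [|k IH] B; first by [].
  by move=> /IH H n; elim/prevz_ind: n => n u; apply: (H n u).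
by have /matrixP/(_ 0 ord0) := w0 0 (const_mx 1); rewrite !mxE mulr1.
Qed.

End Annihilators.

(** * The derived tensor product with a cofiber, and thick subcategories *)

Section KoszulModel.
Variable R : comPzRingType.
Implicit Types X Y Z P T A B : complex R.

(** The identity in equal degrees and zero otherwise; total in the degrees, hence
    usable in formulas that are only relevant when the degrees match. *)
Definition ccast X i n : {linear X i -> X n} :=
  match @eqP _ i n with
  | ReflectT E => match E in _ = m return {linear X i -> X m} with erefl => idfun end
  | ReflectF _ => \0
  end.

Lemma ccastE X n x : ccast X n n x = x.
Proof.
by rewrite /ccast; case: eqP => // E; rewrite (eq_irrelevance E erefl).
Qed.

Lemma sphere_eq0 i n (v : sphere R i n) : (n == i) = false -> v = 0.
Proof. by move=> ni; apply/rowP => k; have := ltn_ord k; rewrite [in X in (_ < X)%N]ni. Qed.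

(** The coordinate of an element of a sphere, whose rows have length 0 or 1. *)
Definition rowsum m (v : 'rV[R]_m) : R := \sum_k v 0 k.

Lemma rowsum_linear m a (u v : 'rV[R]_m) :
  rowsum (a *: u + v) = a * rowsum u + rowsum v.
Proof.
rewrite /rowsum mulr_sumr -big_split /=; apply: eq_bigr => k _.
by rewrite !mxE.
Qed.

Lemma rowsum0 m : rowsum (0 : 'rV[R]_m) = 0.
Proof. by rewrite /rowsum big1 // => k _; rewrite mxE. Qed.

Lemma rowsum1 (v : 'rV[R]_1) : v = rowsum v *: const_mx 1.
Proof. by apply/rowP => k; rewrite /rowsum big_ord1 !mxE mulr1 ord1. Qed.

Lemma sign_prevz m : (-1) ^+ `|prevz m|%N = - (-1) ^+ `|m|%N :> R.
Proof.
rewrite /prevz; case: m => [[|m]|m].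
- by rewrite /= expr0 expr1.
- by rewrite -[(Posz m.+1)]/(Posz (1 + m)) PoszD addrAC subrr add0r /= exprS mulN1r opprK.
- by rewrite NegzE -opprD !abszN -PoszD !absz_nat addn1 exprS mulN1r.
Qed.

(** S/x has basis e0 in degree 0 and e1 in degree 1 with d e1 = x e0, so the tensor
    product with P is P e0 (+) P e1, which up to a sign on the second summand is
    the cone of x on P.  The universal property provides the inverse map. *)
Lemma diso_tensor_cofiber x P T :
  is_tensor P (cofiber_mul x) T -> diso (cmul x P) T.
Proof.
move=> [t [tbil tdiff tex tuniq]].
pose e0 : cofiber_mul x 0 := (const_mx 1, 0).
pose e1 : cofiber_mul x 1 := (0, const_mx 1).
have E0 n : n + 0 = n :> int by rewrite addr0.
have E1 n : prevz n + 1 = n :> int by rewrite /prevz subrK.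
(* The sign of the tensor differential on P e1, moved into the identification. *)
pose eps n : R := (-1) ^+ `|prevz n|%N.
have epsK n : eps n * eps n = 1 by rewrite -expr2 sqrr_sign.
pose th n (v : cmul x P n) : T n :=
  t n 0 n v.1 e0 + eps n *: t (prevz n) 1 n v.2 e1.
have th_lin n : linear (@th n).
  move=> a u v; rewrite /th /=.
  rewrite (proj2 (tbil _ _ _ (E0 n))) (proj2 (tbil _ _ _ (E1 n))) /=.
  by rewrite !scalerDr addrACA !scalerA mulrC.
have tD i j n (E : i + j = n) p p' y : t i j n (p + p') y = t i j n p y + t i j n p' y.
  exact: raddfD (linmap (proj2 (tbil _ _ _ E) y)) p p'.
have tN i j n (E : i + j = n) p y : t i j n (- p) y = - t i j n p y.
  exact: raddfN (linmap (proj2 (tbil _ _ _ E) y)) p.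
have tZ i j n (E : i + j = n) a p y : t i j n (a *: p) y = a *: t i j n p y.
  exact: linearZ_LR (linmap (proj2 (tbil _ _ _ E) y)) a p.
have tZr i j n (E : i + j = n) a p y : t i j n p (a *: y) = a *: t i j n p y.
  exact: linearZ_LR (linmap (proj1 (tbil _ _ _ E) p)) a y.
have t0r i j n (E : i + j = n) p : t i j n p 0 = 0.
  exact: raddf0 (linmap (proj1 (tbil _ _ _ E) p)).
have de0 : diff (cofiber_mul x) 0 e0 = 0.
  by rewrite cmul_diff /= scaler0 addr0 oppr0.
have de1 : diff (cofiber_mul x) 1 e1 = x *: e0.
  rewrite cmul_diff /=; congr pair; first by rewrite /= add0r.
  by rewrite /= scaler0 oppr0.
have th_chain n v : th (prevz n) (diff (cmul x P) n v) = diff T n (th n v).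
  rewrite /th raddfD /= linearZ /= !tdiff // /cone_diff_fun /=.
  rewrite de0 de1 t0r; last by rewrite /prevz sub0r.
  rewrite scaler0 addr0 tD // tN; last by rewrite /prevz subrK.
  rewrite tZ // (tZr _ (prevz 1)); last by rewrite addr0.
  rewrite scalerDr /eps (sign_prevz (prevz n)) scalerN scaleNr opprK -!addrA.
  by rewrite (scalerA _ _ (x *: _)) epsK scale1r [in LHS](addrC (x *: _)).
(* The rowsums vanish unless j = 0, respectively j = 1; the casts are then
   identities, since i + j = n. *)
pose b n i j (p : P i) (y : cofiber_mul x j) : cmul x P n :=
  (rowsum y.1 *: ccast P i n p, (rowsum y.2 * eps n) *: ccast P i (prevz n) p).
have b_bil n i j : bilinear_map (@b n i j).
  split.
    move=> p a y y'; rewrite /b; congr pair; rewrite /= rowsum_linear.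
      by rewrite scalerDl scalerA.
    by rewrite mulrDl scalerDl scalerA mulrA.
  move=> y a p p'; rewrite /b; congr pair; rewrite /= linearP scalerDr !scalerA.
    by rewrite mulrC.
  by rewrite mulrC.
have g_ex n : exists g : {linear T n -> cmul x P n},
    forall i j, i + j = n -> forall p y, g (t i j n p y) = b n i j p y.
  by apply: tex => i j _; apply: b_bil.
have s0 : rowsum (const_mx 1 : 'rV[R]_1) = 1 by rewrite /rowsum big_ord1 mxE.
have thK n : exists g : {linear T n -> cmul x P n}, cancel (th n) g /\ cancel g (th n).
  have [g gP] := g_ex n; exists g; split.
    move=> [u q]; rewrite /th raddfD /= linearZ /= !gP // /b /= !rowsum0 !mul0r.
    rewrite !scale0r !s0 scale1r !ccastE mul1r; congr pair => /=.
      by rewrite scaler0 addr0.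
    by rewrite add0r scalerA epsK scale1r.
  apply: (tuniq n _ (linmap (@th_lin n) \o g)%FUN idfun) => i j E p y /=.
  rewrite gP // /th /b /= !tZ // scalerA.
  have [j0|j0] : j = 0 \/ j <> 0 by case: (j =P 0); [left|right].
    move: y; rewrite j0 => -[y1 y2].
    move: p; have {E} -> : i = n by rewrite -E j0 addr0. 
    move=> p; rewrite ccastE /=.
    rewrite (_ : y2 = 0) ?rowsum0 ?mul0r ?mulr0 ?scale0r ?addr0; last first.
      exact: sphere_eq0.
    rewrite -tZr //; congr (t _ _ _ _ _); congr pair; last by rewrite /= scaler0.
    by rewrite /= -rowsum1.
  have [j1|j1] : j = 1 \/ j <> 1 by case: (j =P 1); [left|right].
    move: y; rewrite j1 => -[y1 y2].
    move: p; have {E} -> : i = prevz n by rewrite -E j1 /prevz addrK. 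
    move=> p; rewrite ccastE /=.
    rewrite (_ : y1 = 0) ?rowsum0 ?scale0r ?add0r; last exact: sphere_eq0.
    rewrite mulrCA epsK mulr1 -tZr //; congr (t _ _ _ _ _).
    congr pair; first by rewrite /= scaler0.
    by rewrite /= -rowsum1.
  have y0 : y = 0.
    rewrite [y]surjective_pairing; congr pair; apply: sphere_eq0.
      exact/eqP.
    by apply/negP => /eqP jj; apply: j1; rewrite -[j](subrK 1) -/(prevz j) jj.
  by rewrite y0 /= !rowsum0 mul0r mulr0 !scale0r addr0 t0r.
apply: (@diso_quasi_iso _ _ _
  (@ChainMap R (cmul x P) T (fun n => linmap (@th_lin n)) th_chain)).
by apply: quasi_iso_bij => n; have [g [gK Kg]] := thK n; exists g.
Qed.

(** Identifies the iterated derived tensor product, which is only known up to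
    isomorphism, with the explicit Koszul complex on the sphere. *)
Lemma diso_koszul xs K : is_koszul xs K -> diso (kos xs (sphere R 0)) K.
Proof.
elim: xs K => //= x xs IH K [K' /IH KK' [P [T [s [qs _ PT TK]]]]].
apply: diso_trans TK; apply: diso_trans (diso_tensor_cofiber PT).
by apply: diso_cmul; apply: diso_trans KK' (diso_sym (diso_quasi_iso qs)).
Qed.

Section Thick.
Variable K : complex R.

Lemma thick_diso X Y : diso X Y -> thick K X -> thick K Y.
Proof. by move=> [f [g [gf fg]]]; apply: (thick_retract fg). Qed.

Lemma exact_triangle_cone X Y (u : chain_map X Y) :
  exact_triangle (dmap_of u) (dmap_of (cone_in u)) (dmap_of (cone_out u)).
Proof.
exists X, Y, u, (did X), (did Y), (did (cone u)).
split; first by split; apply: is_diso_did.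
split; apply: deq_trans (deq_idr _) _; apply: deq_sym; try exact: deq_idl.
apply: deq_trans (deq_idl (dmap_of (cone_out u))).
by apply: deq_compr; apply: deq_of => n x.
Qed.

Lemma thick_cmul x X : thick K X -> thick K (cmul x X).
Proof. by move=> tX; apply: (thick_cofiber3 (exact_triangle_cone _)). Qed.

Lemma thick_sus n X : thick K X -> thick K (sus n X).
Proof. by elim: n X => //= n IH X /thick_susp/IH. Qed.

Section Square.
Variables (x : R) (X : complex R).

(** The octahedral axiom for x composed with x: this map from the cofiber of x to the
    cofiber of x * x has the cofiber of x as its cone (quasi_iso_sq_cone). *)
Definition sq_fun n (v : cmul x X n) : cmul (x * x) X n := (x *: v.1, v.2).
Fact sq_linear n : linear (@sq_fun n).
Proof. by move=> a u v; rewrite /sq_fun; congr pair; rewrite /= linearP. Qed.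
Fact sq_chain n (v : cmul x X n) :
  sq_fun (diff (cmul x X) n v) = diff (cmul (x * x) X) n (sq_fun v).
Proof.
rewrite !cmul_diff /sq_fun /=; congr pair => /=.
by rewrite scalerDr scalerA -linearZ.
Qed.
Definition sq : chain_map (cmul x X) (cmul (x * x) X) :=
  @ChainMap R _ _ (fun n => linmap (@sq_linear n)) sq_chain.

Definition sq_cone_fun n (v : cone sq n) : cmul x X n :=
  (v.1.1, v.2.1 + x *: v.1.2).
Fact sq_cone_linear n : linear (@sq_cone_fun n).
Proof.
move=> a u v; rewrite /sq_cone_fun; congr pair; rewrite /= linearP scalerDr.
by rewrite addrACA.
Qed.
Fact sq_cone_chain n (v : cone sq n) :
  sq_cone_fun (diff (cone sq) n v) = diff (cmul x X) n (sq_cone_fun v).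
Proof.
rewrite cmul_diff /sq_cone_fun /= /cone_diff_fun /=; congr pair => /=.
  by rewrite scalerDr scalerA -addrA (addrC (x *: _)).
have -> : diff X (prevz n) (v.2.1 + x *: v.1.2) =
    diff X (prevz n) v.2.1 + x *: diff X (prevz n) v.1.2.
  by rewrite raddfD /= linearZ.
by rewrite scalerDr scalerN !opprD addrACA addNr addr0.
Qed.
Definition sq_cone : chain_map (cone sq) (cmul x X) :=
  @ChainMap R _ _ (fun n => linmap (@sq_cone_linear n)) sq_cone_chain.

(** The map (y', p', y, p) |-> (y', y + x p') has the section (y', y) |->
    (y', 0, y, 0), and its kernel is spanned by p' and p, which the differential
    of the cone identifies. *)
Lemma quasi_iso_sq_cone : quasi_iso sq_cone.
Proof.
move=> n; split.
  move=> [[y' p'] [y p]]; rewrite /cycle /= /cone_diff_fun /sq_fun /= => -[_ + _ _].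
  rewrite addrC => /eqP; rewrite subr_eq0 => /eqP dp'.
  move=> [[a b]]; rewrite /sq_cone_fun /= /cone_diff_fun /= => -[da db].
  exists ((a, 0), (b, p')); rewrite /= /cone_diff_fun /sq_fun /=.
  congr (_, _, (_, _)); rewrite /= ?scaler0 ?addr0 //.
  - by rewrite raddf0 oppr0 add0r.
  - by rewrite opprD db addrK.
  - by rewrite opprK -dp'.
move=> [y' y]; rewrite /cycle /= /cone_diff_fun /= => -[dy' dy].
exists ((y', 0), (y, 0)).
  rewrite /cycle /= /cone_diff_fun /sq_fun /= !scaler0 !addr0.
  by congr (_, _, (_, _)); rewrite //= ?addr0 (raddf0 (diff X _)) !oppr0.
by exists 0; rewrite /= /sq_cone_fun /= scaler0 addr0 subrr raddf0.
Qed.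

Lemma thick_cmul_sq : thick K (cmul x X) -> thick K (cmul (x * x) X).
Proof.
move=> tX; apply: (thick_cofiber2 (exact_triangle_cone sq)) => //.
exact: thick_diso (diso_sym (diso_quasi_iso quasi_iso_sq_cone)) tX.
Qed.

End Square.

(** Squaring one of the generators, in any position, does not leave the thick
    subcategory. *)
Lemma thick_kos_sq zs x X :
  thick K (kos zs (cmul x X)) -> thick K (kos zs (cmul (x * x) X)).
Proof.
move=> tX; apply: thick_diso (diso_sym (diso_kos_cmul _ _ _)) _.
exact/thick_cmul_sq/(thick_diso (diso_kos_cmul _ _ _)).
Qed.

End Thick.
End KoszulModel.

(** * From the generating hypothesis to the ring *)

Section Idempotent.
Variables (R : comPzRingType) (xs : seq R).

(** Membership in the product of the ideal of xs and the ideal of zs, in a form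
    suited to eliminating the elements of zs one at a time. *)
Fixpoint ideal_comb (zs : seq R) (r : R) : Prop :=
  if zs is z :: zs' then exists2 a, a \in ideal xs & ideal_comb zs' (r - a * z) else r = 0.

Lemma ideal_combD zs r r' : ideal_comb zs r -> ideal_comb zs r' -> ideal_comb zs (r + r').
Proof.
elim: zs r r' => [|z zs IH] r r' /=; first by move=> -> ->; rewrite addr0.
move=> [a aI ra] [b bI rb]; exists (a + b); first exact: rpredD.
by rewrite mulrDl opprD addrACA; apply: IH.
Qed.

Lemma ideal_combM zs b r : ideal_comb zs r -> ideal_comb zs (b * r).
Proof.
elim: zs r => [|z zs IH] r /=; first by move=> ->; rewrite mulr0.
move=> [a aI ra]; exists (b * a); first exact: idealMr.
by rewrite -mulrA -mulrBr; apply: IH.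
Qed.

Lemma ideal_comb_killed zs c r : (forall z, z \in zs -> c * z = 0) -> ideal_comb zs r -> c * r = 0.
Proof.
elim: zs r => [|z zs IH] r cz /=; first by move=> ->; rewrite mulr0.
move=> [a _ /IH H]; rewrite -[r](subrK (a * z)) mulrDr H ?add0r; last first.
  by move=> y yzs; apply: cz; rewrite inE yzs orbT.
by rewrite mulrCA cz ?mulr0 // inE eqxx.
Qed.

(** Nakayama's lemma by elimination: the relation for z expresses (s - a) z through
    the remaining generators, so after multiplying by s - a, still congruent to
    1 modulo the ideal, the other relations no longer involve z. *)
Lemma nakayama zs s : 1 - s \in ideal xs -> (forall z, z \in zs -> ideal_comb zs (s * z)) ->
  exists2 e, e \in ideal xs & forall z, z \in zs -> (1 - e) * z = 0.
Proof.
have M1 a b : 1 - a \in ideal xs -> 1 - b \in ideal xs -> 1 - a * b \in ideal xs.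
  move=> Ha Hb; have -> : 1 - a * b = (1 - a) + a * (1 - b).
    by rewrite mulrBr mulr1 addrA subrK.
  by apply: rpredD => //; apply: idealMr.
elim: zs s => [|z zs IH] s sI H; first by exists 0; rewrite ?rpred0.
(* saz says that (s - a) z is a combination of the remaining generators. *)
have [a aI] := H z (mem_head _ _); rewrite -mulrBl => saz.
have saI : 1 - (s - a) \in ideal xs by rewrite opprB addrCA addrC rpredD.
have [|y yzs|e eI eP] := IH ((s - a) * s); first exact: M1.
  have [b bI sby] : ideal_comb (z :: zs) (s * y) by apply: H; rewrite inE yzs orbT.
  have := ideal_combD (ideal_combM (s - a) sby) (ideal_combM b saz).
  by rewrite mulrBr -mulrA (mulrCA b) subrK.
exists (1 - (1 - e) * (s - a)).
  by apply: M1 => //; rewrite opprB addrC subrK.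
move=> y; rewrite opprB addrC subrK inE => /orP[/eqP ->|/eP ey].
  by rewrite -mulrA; apply: ideal_comb_killed saz => y' /eP.
by rewrite mulrAC ey mul0r.
Qed.

(** The assumption makes the ideal equal to its square, and a finitely generated
    idempotent ideal is generated by an idempotent. *)
Lemma ring_summand_sq : {subset ideal xs <= ideal [seq x * x | x <- xs]} ->
  ring_summand (ideal xs).
Proof.
move=> sub.
have sqcomb zs r : {subset zs <= xs} -> r \in ideal [seq x * x | x <- zs] -> ideal_comb zs r.
  elim: zs r => [|z zs IH] r zsxs /=.
    by move=> /idealP[c ->]; rewrite big1 // => -[].
  move=> /ideal_cons[b]; rewrite mulrA => /IH H; exists (b * z).
    by apply/idealMr/ideal_mem/zsxs; rewrite mem_head.
  by apply: H => y yzs; apply: zsxs; rewrite inE yzs orbT.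
have [||e eI eP] := @nakayama xs 1; first by rewrite subrr rpred0.
  by move=> z zxs; apply: sqcomb => //; rewrite mul1r; apply/sub/ideal_mem.
have eK a : a \in ideal xs -> a = e * a.
  move=> aI; apply/eqP; rewrite -subr_eq0 -{1}[a]mul1r -mulrBl mulrC; apply/eqP.
  by apply: (ideal_ann aI) => y /eP; rewrite mulrC.
exists e; first by rewrite -eK.
move=> a; split=> [/eK ->|[r ->]]; last by rewrite mulrC; apply: idealMr.
by exists a.
Qed.

End Idempotent.

Section Forward.
Variables (R : comPzRingType) (K : complex R).
Hypothesis ghK : GH (thick K).
Let T ys := thick K (kos ys (sphere R 0)).

(** Let I be generated by the list with x and I' by the list with x * x.  If r kills
    I', then x r kills I and lies in I, hence is zero by GH_ann_nil; so x kills
    the annihilator of I', and lies in I' by GH_ideal_ann. *)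
Lemma GH_ideal_sq (ys1 : seq R) x ys2 : T (ys1 ++ x :: ys2) ->
  x \in ideal (ys1 ++ x * x :: ys2).
Proof.
move=> Tys.
have Tys' : T (ys1 ++ x * x :: ys2).
  by move: Tys; rewrite /T /kos !foldr_cat; apply: thick_kos_sq.
apply: (GH_ideal_ann ghK Tys' (thick_sus _ Tys')) => r rann.
have xr : annihilates (ys1 ++ x :: ys2) (x * r).
  move=> y; rewrite mem_cat inE => /or3P[yin|/eqP ->|yin].
  - by rewrite mulrCA rann ?mulr0 // mem_cat yin.
  - by rewrite mulrA rann // mem_cat mem_head orbT.
  - by rewrite mulrCA rann ?mulr0 // mem_cat inE yin !orbT.
rewrite (GH_ann_nil ghK Tys xr) ?rpred0 // => r' /(ideal_ann _); apply.
by rewrite mulrC; apply/idealMr/ideal_mem; rewrite mem_cat mem_head orbT.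
Qed.

(** Replacing the generators by their squares one at a time never shrinks the ideal,
    and never leaves the thick subcategory. *)
Lemma GH_ideal_sqs (ys1 ys2 : seq R) : T (ys1 ++ ys2) ->
  {subset ideal (ys1 ++ ys2) <= ideal (ys1 ++ [seq x * x | x <- ys2])}.
Proof.
elim: ys2 ys1 => [|x ys2 IH] ys1 Tys //= r rI.
have Tys' : T (ys1 ++ x * x :: ys2).
  by move: Tys; rewrite /T /kos !foldr_cat; apply: thick_kos_sq.
rewrite -cat_rcons; apply: IH; rewrite cat_rcons //.
move: r rI; apply: ideal_sub => y; rewrite mem_cat inE => /or3P[yin|/eqP ->|yin].
- by apply: ideal_mem; rewrite mem_cat yin.
- exact: GH_ideal_sq.
- by apply: ideal_mem; rewrite mem_cat inE yin !orbT.
Qed.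

Lemma GH_ring_summand xs : T xs -> ring_summand (ideal xs).
Proof. by move=> Txs; apply/ring_summand_sq/(@GH_ideal_sqs [::]). Qed.

(** The extra generator x gives the cofiber of x on the Koszul complex, so that
    GH_ideal_sq puts x in the ideal generated by x * x and xs. *)
Lemma GH_von_neumann_regular xs : T xs -> von_neumann_regular (ideal_quot xs).
Proof.
move=> Txs z; pose x : R := repr z.
have /ideal_cons[b bI] : x \in ideal (x * x :: xs).
  by apply: (@GH_ideal_sq [::]); apply: thick_cmul.
exists (\pi_(ideal_quot xs) b); rewrite -[z]reprK -/x.
rewrite -[LHS]/(iquot_mul (iquot_mul (\pi x) (\pi b)) (\pi x)) -!pi_iquot_mul.
apply/eqP; rewrite eq_sym -Quotient.idealrBE.
by rewrite (mulrC x b) -mulrA.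
Qed.

End Forward.

(** * Linear algebra over a von Neumann regular corner *)

Section Regular.
Variables (R : comPzRingType) (f : R).
Hypothesis ff : f * f = f.
Hypothesis vnr : forall x : R, exists y, f * (x * y * x) = f * x.

Definition regular_mx m k (A : 'M[R]_(m, k)) : Prop := exists B, A *m B *m A = A.

(** With E = a b the idempotent projecting onto the column space of a, a generalized
    inverse d of u' = u - E u can be replaced by d (1 - E), which kills a; so the
    two column spaces are treated independently. *)
Lemma regular_row_mx m k (a : 'M[R]_(m, 1)) (u : 'M[R]_(m, k)) :
  regular_mx a -> (forall u' : 'M[R]_(m, k), f *: u' = u' -> regular_mx u') ->
  f *: u = u -> regular_mx (row_mx a u).
Proof.
move=> [b aba] Hu fu; pose E := a *m b.
have EE : E *m E = E by rewrite /E mulmxA aba.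
pose u' := u - E *m u.
have [|d udu] := Hu u'; first by rewrite scalerBr scalemxAr fu.
have Eu' : E *m u' = 0 by rewrite mulmxBr mulmxA EE subrr.
have Ea : E *m a = a by rewrite /E aba.
pose d' := d *m (1%:M - E).
have d'a : d' *m a = 0 by rewrite -mulmxA mulmxBl mul1mx Ea subrr mulmx0.
have d'u : d' *m u = d *m u' by rewrite -mulmxA mulmxBl mul1mx.
exists (col_mx (b - b *m u *m d') d').
have AB : a *m (b - b *m u *m d') + u *m d' = E + u' *m d'.
  rewrite mulmxBr !mulmxA -/E /u' -addrA; congr (_ + _).
  by rewrite addrC !mulmxBl.
rewrite mul_row_col AB mul_mx_row !(mulmxDl E) -!(mulmxA u') d'a d'u mulmx0 addr0 Ea.
by rewrite mulmxA udu /u' addrC subrK.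
Qed.

Lemma regular_mx_col m :
  (forall a : 'M[R]_(m, 1), f *: a = a -> regular_mx a) ->
  forall k (A : 'M[R]_(m, k)), f *: A = A -> regular_mx A.
Proof.
move=> H1; elim=> [|k IH] A fA.
  by exists 0; apply/matrixP => i [].
rewrite -[A](@hsubmxK _ m 1 k); apply: regular_row_mx => //.
  by apply: H1; rewrite -[RHS](congr1 (@lsubmx _ m 1 k) fA) linearZ.
by rewrite -[RHS](congr1 (@rsubmx _ m 1 k) fA) linearZ.
Qed.

(** Columns are adjoined one at a time by regular_mx_col.  A single column is the
    transpose of a row, whose columns are scalars. *)
Lemma regular_mx_vnr m k (A : 'M[R]_(m, k)) : f *: A = A -> regular_mx A.
Proof.
apply: regular_mx_col => {k A} a fa.
have fat : f *: a^T = a^T by rewrite -linearZ /= fa.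
have [|B BP] := @regular_mx_col 1 _ m a^T fat; last first.
  by exists B^T; apply: trmx_inj; rewrite !trmx_mul trmxK mulmxA.
move=> b fb; have [y yP] := vnr (b 0 0).
exists (y%:M); rewrite mul_mx_scalar -scalemxAl; apply/matrixP => i j.
rewrite !mxE big_ord1 !ord1.
have fb0 : f * b 0 0 = b 0 0 by have /matrixP/(_ 0 0) := fb; rewrite mxE.
have E : b 0 0 * y * b 0 0 = b 0 0 by rewrite -[RHS]fb0 -yP 2!mulrA fb0.
by rewrite -[RHS]E (mulrC (b 0 0) y) mulrA.
Qed.

(** Multiplication by f factors through a free module of finite rank.  For f = 1
    this is the dual basis criterion for being finitely generated projective; for
    an idempotent f it says so of the summand f M. *)
Definition factors_free (M : lmodType R) : Prop :=
  exists m (s : {linear 'rV[R]_m -> M}) (r : {linear M -> 'rV[R]_m}),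
    forall z, s (r z) = f *: z.

Lemma factors_free_rV m : factors_free 'rV[R]_m.
Proof. by exists m, (f \*: idfun)%FUN, idfun. Qed.

Lemma factors_free_retract (M N : lmodType R) (i : {linear N -> M}) (p : {linear M -> N}) :
  cancel i p -> factors_free M -> factors_free N.
Proof.
move=> ip [m [s [r sr]]]; exists m, (p \o s)%FUN, (r \o i)%FUN => z /=.
by rewrite sr linearZ /= ip.
Qed.

(** A linear map between summands of free modules is, up to these summands, a
    matrix, and a generalized inverse of the matrix gives one of the map. *)
Lemma factors_free_regular (M N : lmodType R) (a : {linear M -> N}) :
  factors_free M -> factors_free N ->
  exists a' : {linear N -> M}, forall z, f *: a (a' (a z)) = f *: a z.
Proof.
move=> [m [s1 [r1 sr1]]] [k [s2 [r2 sr2]]].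
pose A := lin1_mx (r2 \o a \o s1)%FUN.
have AE v : v *m A = r2 (a (s1 v)) by rewrite mul_rV_lin1.
have [|B] := @regular_mx_vnr _ _ (f *: A); first by rewrite scalerA ff.
rewrite -scalemxAl -scalemxAr -scalemxAl scalerA ff => BP.
have a'_lin : linear (fun z => s1 (r2 z *m B)).
  by move=> c u v; rewrite linearP mulmxDl -scalemxAl linearP.
exists (linmap a'_lin) => z /=; set y := a z.
have fs w : f *: a (s1 w) = s2 (w *m A) by rewrite AE sr2.
have fr : f *: r2 y = r1 z *m A by rewrite AE sr1 !linearZ.
have ffs (x : N) : f *: x = f *: (f *: (f *: x)) by rewrite !scalerA !ff.
rewrite ffs fs.
have -> : f *: s2 (r2 y *m B *m A) = s2 (r1 z *m A *m B *m A).
  by rewrite -fr -linearZ /= -!scalemxAl.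
have -> : f *: s2 (r1 z *m A *m B *m A) = f *: s2 (r1 z *m A).
  have -> : r1 z *m A *m B *m A = r1 z *m (A *m B *m A) by rewrite !mulmxA.
  by rewrite -2!(linearZ_LR s2) scalemxAr BP -scalemxAr.
by rewrite -fr linearZ /= sr2 -!ffs.
Qed.

(** In the von Neumann regular corner of f, the cokernel of a and the kernel of d are
    again finitely generated projective, and M3 is an extension of the latter by the
    former.  Here q projects M4 onto the kernel of d, kap splits M3 over it, and t
    projects M2 onto a complement of the image of a. *)
Lemma factors_free_five (M1 M2 M3 M4 M5 : lmodType R)
    (a : {linear M1 -> M2}) (b : {linear M2 -> M3})
    (c : {linear M3 -> M4}) (d : {linear M4 -> M5}) :
  (forall x, b (a x) = 0) -> (forall y, b y = 0 -> exists x, a x = y) ->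
  (forall z, c z = 0 -> exists y, b y = z) ->
  (forall z, d (c z) = 0) -> (forall w, d w = 0 -> exists z, c z = w) ->
  factors_free M1 -> factors_free M2 -> factors_free M4 -> factors_free M5 -> factors_free M3.
Proof.
move=> ba exb exc dc exd F1 F2 F4 F5.
have [a' a'P] := factors_free_regular a F1 F2; have [d' d'P] := factors_free_regular d F4 F5.
have [m2 [s2 [r2 sr2]]] := F2; have [m4 [s4 [r4 sr4]]] := F4.
pose q : {linear M4 -> M4} := (f \*: (idfun \- (d' \o d)))%FUN.
have [kap kapP] : exists kap : {linear 'rV[R]_m4 -> M3},
    forall v, c (kap v) = (q \o s4)%FUN v.
  apply: projective_rV => v; apply: exd.
  by rewrite /= linearZ linearB /= scalerBr d'P subrr.
(* zeta z is the part of f z in the image of b. *)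
pose zeta : {linear M3 -> M3} := ((f \*: idfun) \- (kap \o r4 \o c))%FUN.
have qc z : q (c z) = f *: c z by rewrite /= dc linear0 subr0.
have zetaP z : c (zeta z) = 0.
  have -> : c (zeta z) = f *: c z - c (kap (r4 (c z))).
    by rewrite /= linearB linearZ.
  by rewrite kapP -[(q \o s4)%FUN _]/(q (s4 _)) sr4 (linearZ_LR q) qc scalerA ff subrr.
pose y z := sval (boolp.cid (exc _ (zetaP z))).
have yP z : b (y z) = zeta z by rewrite /y; case: boolp.cid.
pose t : {linear M2 -> M2} := (f \*: (idfun \- (a \o a')))%FUN.
(* t kills the image of a, so that t (y z) does not depend on the choice of y z. *)
have psi_lin : linear (fun z => t (y z)).
  move=> x u v; rewrite -linearP; apply/eqP; rewrite -subr_eq0 -linearB.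
  have [|w <-] := exb (y (x *: u + v) - (x *: y u + y v)).
    by rewrite linearB linearP !yP linearP subrr.
  by rewrite /= scalerBr a'P subrr.
have bt z : b (t (y z)) = f *: zeta z.
  by rewrite /= linearZ linearB /= ba subr0 yP.
have r_lin : linear (fun z => row_mx (r4 (c z)) (r2 (t (y z)))).
  by move=> x u v; rewrite psi_lin !linearP scale_row_mx add_row_mx.
have s_lin : linear (fun v : 'rV[R]_(m4 + m2) =>
    f *: kap (lsubmx v) + b (s2 (rsubmx v))).
  exact: (linearP ((f \*: (kap \o lsubmx)) \+ (b \o s2 \o rsubmx))%FUN).
exists (m4 + m2)%N, (linmap s_lin), (linmap r_lin) => z /=.
rewrite row_mxKl row_mxKr sr2 linearZ bt -scalerDr.
by rewrite scalerDr scalerA ff -scalerDr /zeta /= addrC subrK scalerA ff.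
Qed.

End Regular.

(** * Homology modules *)

Section Homology.
Variable R : comPzRingType.
Implicit Types X Y Z : complex R.

Definition is_cycle X n : {pred X n} := fun z => `[< diff X n z = 0 >].

(** Stated in every degree n, whereas boundary speaks of the degrees prevz n
    only; is_boundaryP says that both agree there. *)
Definition is_boundary X n : {pred X n} :=
  fun z => `[< exists m (w : X m), prevz m = n /\ ccast X (prevz m) n (diff X m w) = z >].

Lemma is_cycleP X n (z : X n) : reflect (diff X n z = 0) (z \in is_cycle (n:=n)).
Proof. exact: asboolP. Qed.

Lemma is_boundaryP X n (z : X (prevz n)) :
  reflect (boundary z) (z \in is_boundary (n:=prevz n)).
Proof.
apply: (iffP (asboolP _)) => [[m [w [/prevz_inj E <-]]]|[w <-]].
  by move: w; rewrite E => w; exists w; rewrite ccastE.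
by exists n, w; rewrite ccastE.
Qed.

Fact is_cycle_closed X n : submod_closed (@is_cycle X n).
Proof.
split; first by apply/is_cycleP; rewrite raddf0.
by move=> a u v /is_cycleP du /is_cycleP dv; apply/is_cycleP; rewrite linearP du dv scaler0 addr0.
Qed.

Fact is_boundary_closed X n : submod_closed (@is_boundary X n).
Proof.
elim/prevz_ind: n => n.
split; first by apply/is_boundaryP; exists 0; rewrite raddf0.
move=> a u v /is_boundaryP[u' <-] /is_boundaryP[v' <-].
by apply/is_boundaryP; exists (a *: u' + v'); rewrite linearP.
Qed.

HB.instance Definition _ X n :=
  GRing.isSubmodClosed.Build R (X n) (@is_cycle X n) (@is_cycle_closed X n).

Record cycles X n := Cycles { cval :> X n; _ : cval \in is_cycle (n:=n) }.
HB.instance Definition _ X n := [isSub for @cval X n].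
HB.instance Definition _ X n := [Choice of cycles X n by <:].
HB.instance Definition _ X n := [SubChoice_isSubLmodule of cycles X n by <:].

Definition bcycles X n : {pred cycles X n} := fun z => val z \in is_boundary (n:=n).

Fact bcycles_closed X n : submod_closed (@bcycles X n).
Proof.
have [b0 bD] := is_boundary_closed X n.
split; first exact: b0.
by move=> a u v ub vb; exact: bD ub vb.
Qed.

HB.instance Definition _ X n :=
  GRing.isSubmodClosed.Build R (cycles X n) (@bcycles X n) (@bcycles_closed X n).

Definition homology X n : Type := Quotient.quot (@bcycles X n).
HB.instance Definition _ X n := GRing.Zmodule.on (homology X n).
HB.instance Definition _ X n :
    EqQuotient (cycles X n) (Quotient.equiv (@bcycles X n)) (homology X n) :=
  EqQuotient.on (homology X n).

Section Scale.
Variables (X : complex R) (n : int).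
Local Notation H := (homology X n).
Local Notation cl := (\pi_(homology X n)).

Definition hscale (a : R) (h : H) : H := cl (a *: repr h).

Fact pi_hclassD : {morph cl : u v / u + v >-> u + v}.
Proof. exact: Quotient.pi_add. Qed.

Fact pi_hscale a z : hscale a (cl z) = cl (a *: z).
Proof.
apply/eqP; rewrite -Quotient.idealrBE -scalerBr rpredZ //.
by rewrite Quotient.idealrBE reprK.
Qed.

Fact hscaleA a b (h : H) : hscale a (hscale b h) = hscale (a * b) h.
Proof. by rewrite -[h]reprK (pi_hscale b) !pi_hscale scalerA. Qed.
Fact hscale1 : left_id 1 hscale.
Proof. by move=> h; rewrite -[h]reprK pi_hscale scale1r. Qed.
Fact hscaleDr : right_distributive hscale +%R.
Proof.
move=> a h k; rewrite -[h]reprK -[k]reprK -pi_hclassD !pi_hscale scalerDr.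
exact: pi_hclassD.
Qed.
Fact hscaleDl h : {morph hscale^~ h : a b / a + b}.
Proof.
move=> a b; rewrite -[h]reprK !pi_hscale scalerDl; exact: pi_hclassD.
Qed.
HB.instance Definition _ := GRing.Zmodule_isLmodule.Build R H
  hscaleA hscale1 hscaleDr hscaleDl.

Fact hclass_linear : linear (cl : cycles X n -> H).
Proof.
by move=> a u v; rewrite pi_hclassD -pi_hscale.
Qed.

End Scale.

(** Defined on all chains, with a junk value outside the cycles, so that no proof
    of being a cycle has to be carried along. *)
Definition hclass X n (z : X n) : homology X n := \pi_(homology X n) (insubd 0 z).

Lemma hclass_cycle X n (z : cycles X n) : hclass (val z) = \pi_(homology X n) z.
Proof. by rewrite /hclass valKd. Qed.

Lemma hclassP X n (h : homology X n) : exists2 z : X n, diff X n z = 0 & hclass z = h.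
Proof.
exists (val (repr h)); last by rewrite hclass_cycle reprK.
exact/is_cycleP/(valP (repr h)).
Qed.

Lemma hclass_linear_cycle X n a (u v : X n) : diff X n u = 0 -> diff X n v = 0 ->
  hclass (a *: u + v) = a *: hclass u + hclass v.
Proof.
move=> /is_cycleP cu /is_cycleP cv.
rewrite -[u]/(val (Cycles cu)) -[v]/(val (Cycles cv)) -linearP !hclass_cycle.
exact: hclass_linear.
Qed.

Lemma hclass_eq0 X n (z : X (prevz n)) : cycle z -> hclass z = 0 <-> boundary z.
Proof.
move=> /is_cycleP cz; rewrite -[z in hclass z]/(val (Cycles cz)) hclass_cycle.
rewrite -[X in _ = X <-> _](raddf0 (linmap (@hclass_linear X (prevz n)))) /=.
split=> [/eqP|bz].
  by rewrite -Quotient.idealrBE subr0 => /is_boundaryP.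
by apply/eqP; rewrite -Quotient.idealrBE subr0; apply/is_boundaryP.
Qed.

(** The universal property of homology, for functions that are only linear on
    cycles, as hclass is. *)
Lemma homology_map X n (V : lmodType R) (phi : X n -> V) :
  (forall a u v, diff X n u = 0 -> diff X n v = 0 ->
     phi (a *: u + v) = a *: phi u + phi v) ->
  (forall z, diff X n z = 0 -> hclass z = 0 -> phi z = 0) ->
  exists g : {linear homology X n -> V}, forall z, diff X n z = 0 -> g (hclass z) = phi z.
Proof.
move=> phiP phi0.
have wd u v : diff X n u = 0 -> diff X n v = 0 -> hclass u = hclass v -> phi u = phi v.
  move=> du dv uv; have := phiP (-1) v u dv du.
  rewrite phi0; last by rewrite hclass_linear_cycle // uv scaleN1r addNr.
    by rewrite scaleN1r addrC => /esym/eqP; rewrite subr_eq0 => /eqP.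
  by rewrite linearP du dv scaler0 addr0.
pose g h := phi (val (repr (h : homology X n))).
have gE z : diff X n z = 0 -> g (hclass z) = phi z.
  move=> dz; apply: wd => //; first exact/is_cycleP/(valP (repr _)).
  by rewrite hclass_cycle reprK.
have g_lin : linear g.
  move=> a h k; have [u du <-] := hclassP h; have [v dv <-] := hclassP k.
  rewrite -hclass_linear_cycle // !gE ?phiP //.
  by rewrite linearP du dv scaler0 addr0.
by exists (linmap g_lin).
Qed.

End Homology.

(** * Homology as a functor on the derived category *)

Section HomologyFunctor.
Variable R : comPzRingType.
Implicit Types X Y Z : complex R.

Lemma hclass0 X n : hclass (0 : X n) = 0.
Proof.
elim/prevz_ind: n => n; apply/hclass_eq0; first by rewrite /cycle raddf0.
by exists 0; rewrite raddf0.
Qed.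

Lemma hclassZ X n a (z : X n) : diff X n z = 0 -> hclass (a *: z) = a *: hclass z.
Proof.
move=> dz; have := @hclass_linear_cycle _ X n a z 0 dz (raddf0 _).
by rewrite addr0 hclass0 addr0.
Qed.

Lemma hclass_eq X n (u v : X (prevz n)) : cycle u -> cycle v ->
  hclass u = hclass v <-> boundary (u - v).
Proof.
move=> cu cv; have cuv : cycle (u - v) by rewrite /cycle raddfB /= cu cv subrr.
rewrite -(hclass_eq0 cuv) addrC -scaleN1r hclass_linear_cycle // scaleN1r addrC.
by split=> [->|/eqP]; [rewrite subrr|rewrite subr_eq0 => /eqP].
Qed.

Lemma homology_chain_map X Y (f : chain_map X Y) n :
  exists g : {linear homology X n -> homology Y n},
    forall z, diff X n z = 0 -> g (hclass z) = hclass (f n z).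
Proof.
apply: homology_map => [a u v du dv|].
  by rewrite linearP hclass_linear_cycle // -cmapP ?du ?dv raddf0.
elim/prevz_ind: n => n z dz /hclass_eq0 bz.
have [w dw] := bz dz; apply/hclass_eq0; first by rewrite /cycle -cmapP dz raddf0.
by exists (f n w); rewrite -cmapP dw.
Qed.

Definition hmap_of X Y (f : chain_map X Y) n := sval (boolp.cid (homology_chain_map f n)).

Lemma hmap_ofE X Y (f : chain_map X Y) n z :
  diff X n z = 0 -> hmap_of f n (hclass z) = hclass (f n z).
Proof. by rewrite /hmap_of; case: boolp.cid => g gP /=; apply: gP. Qed.

Lemma hmap_of_inv X Y (s : chain_map X Y) (qs : quasi_iso s) n :
  exists g : {linear homology Y n -> homology X n},
    cancel (hmap_of s n) g /\ cancel g (hmap_of s n).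
Proof.
have [inj sur] : injective (hmap_of s n) /\ (forall h, exists k, hmap_of s n k = h).
  elim/prevz_ind: n => n; have [qinj qsur] := qs n; split.
    move=> h k; have [u cu <-] := hclassP h; have [v cv <-] := hclassP k.
    have cs w : cycle w -> cycle (s (prevz n) w) by rewrite /cycle -cmapP => ->; rewrite raddf0.
    rewrite !hmap_ofE // => /(hclass_eq (cs _ cu) (cs _ cv)); rewrite -raddfB => b.
    by apply/hclass_eq => //; apply: qinj => //; rewrite /cycle raddfB /= cu cv subrr.
  move=> h; have [w cw <-] := hclassP h; have [z cz b] := qsur w cw.
  exists (hclass z); rewrite hmap_ofE //; apply/esym/hclass_eq => //.
  by rewrite /cycle -cmapP cz raddf0.
pose g h := sval (boolp.cid (sur h)).
have gK : cancel g (hmap_of s n) by move=> h; rewrite /g; case: boolp.cid.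
have g_lin : linear g by move=> a u v; apply: inj; rewrite linearP !gK.
by exists (linmap g_lin); split=> // h; apply: inj; rewrite gK.
Qed.

(** Quasi-isomorphisms are inverted on homology, so homology is defined on formal
    composites; hmap_deq says that it factors through the localization. *)
Fixpoint hmap X Y (f : dmap X Y) n : {linear homology X n -> homology Y n} :=
  match f with
  | dmap_of _ _ f => hmap_of f n
  | dmap_inv _ _ _ qs => sval (boolp.cid (hmap_of_inv qs n))
  | dcomp _ _ _ g f => (hmap g n \o hmap f n)%FUN
  end.

Lemma hmap_of_id X n h : hmap_of (Defs.cid X) n h = h.
Proof. by have [z dz <-] := hclassP h; rewrite hmap_ofE. Qed.

Lemma hmap_deq X Y (f g : dmap X Y) : deq f g -> forall n h, hmap f n h = hmap g n h.
Proof.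
elim=> {X Y f g} /=.
- by [].
- by move=> X Y f g _ IH n h.
- by move=> X Y f g k _ IH1 _ IH2 n h; rewrite IH1.
- by move=> X Y Z g g' f f' _ IH1 _ IH2 n h; rewrite IH1 IH2.
- by [].
- by move=> X Y f n h; rewrite hmap_of_id.
- by move=> X Y f n h; rewrite hmap_of_id.
- by move=> X Y f g fg n h; have [z dz <-] := hclassP h; rewrite !hmap_ofE // fg.
- move=> X Y Z g f n h; have [z dz <-] := hclassP h.
  by rewrite !hmap_ofE //= -?cmapP ?dz ?raddf0.
- by move=> X Y s qs n h; rewrite hmap_of_id; case: boolp.cid => g [gK Kg] /=.
- by move=> X Y s qs n h; rewrite hmap_of_id; case: boolp.cid => g [gK Kg] /=.
Qed.

Lemma hmap_retract X Y (i : dmap X Y) (r : dmap Y X) n :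
  deq (dcomp r i) (did X) -> cancel (hmap i n) (hmap r n).
Proof. by move=> /hmap_deq ri h; have := ri n h; rewrite /= hmap_of_id. Qed.

(** Exactness at the homology of Y, on representatives, which are easier to chase
    than classes; hexact_hmap translates it to homology modules. *)
Definition hexact X Y Z (f : chain_map X Y) (g : chain_map Y Z) : Prop :=
  (forall n (x : X (prevz n)), cycle x -> boundary (g _ (f _ x))) /\
  (forall n (y : Y (prevz n)), cycle y -> boundary (g _ y) ->
     exists2 x : X (prevz n), cycle x & boundary (y - f _ x)).

Lemma susp_cycle X n (z : X (prevz (prevz n))) : @cycle _ (susp X) n z <-> cycle z.
Proof. by rewrite /cycle /=; split=> [/eqP|->]; rewrite ?oppr0 ?oppr_eq0 // => /eqP. Qed.

Lemma susp_boundary X n (z : X (prevz (prevz n))) :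
  @boundary _ (susp X) n z <-> boundary z.
Proof. by split=> -[w <-]; exists (- w); rewrite /= raddfN ?opprK. Qed.

Lemma hexact_susp X Y Z (f : chain_map X Y) (g : chain_map Y Z) :
  hexact f g -> hexact (csusp f) (csusp g).
Proof.
move=> [gf fg]; split=> n.
  by move=> x /susp_cycle /gf bx; apply/susp_boundary.
move=> y /susp_cycle cy /susp_boundary /(fg _ _ cy)[x cx bx].
by exists x; [apply/susp_cycle|apply/susp_boundary].
Qed.

Section HexactCone.
Variables (X Y : complex R) (u : chain_map X Y).

Lemma hexact_cone1 : hexact u (cone_in u).
Proof.
split=> n.
  move=> x cx; exists (0, x); rewrite /= /cone_diff_fun /cone_in_fun /= raddf0 add0r.
  by rewrite cx oppr0.
move=> y cy [[v x]]; rewrite /= /cone_diff_fun /cone_in_fun /= => -[<- /eqP].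
rewrite oppr_eq0 => /eqP dx; exists x => //; exists v; rewrite addrK //.
Qed.

Lemma hexact_cone2 : hexact (cone_in u) (cone_out u).
Proof.
split=> n.
  by move=> y cy; exists 0; rewrite /= /cone_out_fun /cone_in_fun /= raddf0 oppr0.
move=> [y x]; rewrite /cycle /= /cone_diff_fun /= => -[dy dx].
rewrite /cone_out_fun /= => -[q /= dq].
exists (y - u _ q).
  by rewrite /cycle raddfB /= -cmapP -[RHS]dy -dq raddfN.
exists (0, q); rewrite /= /cone_diff_fun /cone_in_fun /= raddf0 add0r dq.
by congr pair; rewrite /= ?subr0 // opprB addrC subrK.
Qed.

Lemma hexact_cone3 : hexact (cone_out u) (csusp u).
Proof.
split=> n.
  move=> [y x]; rewrite /cycle /= /cone_diff_fun /= => -[dy dx].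
  by exists y; rewrite /= /cone_out_fun /=; apply/eqP; rewrite eq_sym -addr_eq0 addrC dy.
move=> x cx [y /= dy]; exists (y, x).
  by move: cx; rewrite /cycle /= /cone_diff_fun /= -dy subrr => ->.
by exists 0; rewrite /= /cone_out_fun subrr raddf0 oppr0.
Qed.

End HexactCone.

Lemma hexact_hmap X Y Z (f : chain_map X Y) (g : chain_map Y Z) : hexact f g ->
  forall n, (forall h, hmap_of g n (hmap_of f n h) = 0) /\
    (forall k, hmap_of g n k = 0 -> exists h, hmap_of f n h = k).
Proof.
move=> [gf fg]; elim/prevz_ind => n.
have cf (W V : complex R) (k : chain_map W V) w : cycle w -> cycle (k (prevz n) w).
  by rewrite /cycle -cmapP => ->; rewrite raddf0.
split=> [h|k].
  have [z cz <-] := hclassP h; rewrite !hmap_ofE //; last exact: cf.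
  by apply/hclass_eq0; [exact/cf/cf|apply: gf].
have [y cy <-] := hclassP k; rewrite hmap_ofE // => /(hclass_eq0 (cf _ _ g _ cy)) by_.
have [x cx bx] := fg n y cy by_; exists (hclass x); rewrite hmap_ofE //.
by apply/esym/hclass_eq => //; apply: cf.
Qed.

End HomologyFunctor.

(** * From the ring to the generating hypothesis *)

Section Backward.
Variable R : comPzRingType.
Implicit Types X Y Z A B C : complex R.

(** The suspension negates the differential, which changes neither cycles nor
    boundaries. *)
Lemma susp_homology X n :
  exists (i : {linear homology (susp X) n -> homology X (prevz n)})
         (p : {linear homology X (prevz n) -> homology (susp X) n}),
    cancel i p /\ cancel p i.
Proof.
elim/prevz_ind: n => n.
have scX (z : X (prevz (prevz n))) : diff (susp X) (prevz n) z = 0 <-> diff X _ z = 0.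
  exact: susp_cycle.
have sbX (z : X (prevz (prevz n))) : diff X _ z = 0 ->
    @hclass _ (susp X) (prevz n) z = 0 <-> hclass z = 0.
  move=> dz; have sdz : @cycle _ (susp X) n z by apply/scX.
  split.
    by move=> /(hclass_eq0 sdz)/susp_boundary bz; apply/hclass_eq0.
  by move=> /(hclass_eq0 dz) bz; apply/(hclass_eq0 sdz)/susp_boundary.
have [||i iP] := @homology_map _ (susp X) (prevz n) (homology X (prevz (prevz n)))
    (fun z => @hclass _ X (prevz (prevz n)) z).
- by move=> a u v /scX du /scX dv; apply: hclass_linear_cycle.
- by move=> z /scX dz; apply: (proj1 (sbX z dz)).
have [||p pP] := @homology_map _ X (prevz (prevz n)) (homology (susp X) (prevz n))
    (fun z => @hclass _ (susp X) (prevz n) z).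
- by move=> a u v /scX du /scX dv; apply: hclass_linear_cycle.
- by move=> z dz; apply: (proj2 (sbX z dz)).
exists i, p; split=> h.
  by have [z dz <-] := hclassP h; rewrite iP // pP //; apply/scX.
by have [z dz <-] := hclassP h; rewrite pP // iP //; apply/scX.
Qed.

Variable e : R.
Hypothesis ee : e * e = e.
Let f := 1 - e.
Hypothesis vnr : forall x : R, exists y, f * (x * y * x) = f * x.

Let ff : f * f = f.
Proof. by rewrite /f mulrBr mulr1 mulrBl mul1r ee subrr subr0. Qed.

Definition homology_factors_free X := forall n, factors_free f (homology X n).
Definition homology_killed X := forall n (h : homology X n), e *: h = 0.

Lemma homology_factors_free_five (X1 X2 X3 X4 X5 : complex R) (a : chain_map X1 X2)
    (b : chain_map X2 X3) (c : chain_map X3 X4) (d : chain_map X4 X5) :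
  hexact a b -> hexact b c -> hexact c d ->
  homology_factors_free X1 -> homology_factors_free X2 ->
  homology_factors_free X4 -> homology_factors_free X5 ->
  homology_factors_free X3.
Proof.
move=> /hexact_hmap ab /hexact_hmap bc /hexact_hmap cd F1 F2 F4 F5 n.
have [ba exb] := ab n; have [_ exc] := bc n; have [dc exd] := cd n.
exact: (factors_free_five ff vnr ba exb exc dc exd (F1 n) (F2 n) (F4 n) (F5 n)).
Qed.

(** An extension of modules killed by e is killed by e * e. *)
Lemma homology_killed_mid X Y Z (a : chain_map X Y) (b : chain_map Y Z) :
  hexact a b -> homology_killed X -> homology_killed Z -> homology_killed Y.
Proof.
move=> /hexact_hmap ab KX KZ n h; have [_ exa] := ab n.
have [k hk] : exists k, hmap_of a n k = e *: h by apply: exa; rewrite linearZ /= KZ.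
by rewrite -ee -scalerA -hk -linearZ /= KX raddf0.
Qed.

(** With f = 1 - e, both conditions together say that every homology module is
    finitely generated projective over R / eR.  They are kept apart because the
    Koszul complexes on part of the generators need only satisfy the first. *)
Definition fgp_homology X := homology_factors_free X /\ homology_killed X.

Lemma homology_factors_free_susp X : homology_factors_free (susp X) <-> homology_factors_free X.
Proof.
split=> FX; last first.
  by move=> n; have [i [p [ip _]]] := susp_homology X n; exact: (factors_free_retract ip (FX _)).
elim/prevz_ind=> n; have [i [p [_ pi]]] := susp_homology X n.
exact: (factors_free_retract pi (FX _)).
Qed.

Lemma homology_killed_susp X : homology_killed (susp X) <-> homology_killed X.
Proof.
split=> KX; last first.
  move=> n h; have [i [p [ip _]]] := susp_homology X n.
  by rewrite -[h]ip -linearZ /= KX raddf0.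
elim/prevz_ind=> n h; have [i [p [_ pi]]] := susp_homology X n.
by rewrite -[h]pi -linearZ /= KX raddf0.
Qed.

Lemma fgp_homology_susp X : fgp_homology (susp X) <-> fgp_homology X.
Proof.
by split=> -[/homology_factors_free_susp FX /homology_killed_susp KX].
Qed.

Lemma fgp_homology_retract X Y (i : dmap X Y) (r : dmap Y X) :
  deq (dcomp r i) (did X) -> fgp_homology Y -> fgp_homology X.
Proof.
move=> ri [FY KY]; split=> n; first exact: (factors_free_retract (hmap_retract (n:=n) ri) (FY n)).
by move=> h; rewrite -[h](hmap_retract (n:=n) ri) -linearZ /= KY raddf0.
Qed.

Lemma fgp_homology_diso X Y (u : dmap X Y) : is_diso u -> fgp_homology X <-> fgp_homology Y.
Proof.
move=> [v [vu uv]].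
by split; [apply: fgp_homology_retract uv|apply: fgp_homology_retract vu].
Qed.

Section TwoOfThree.
Variables (A B : complex R) (u : chain_map A B).

Let ex1 := hexact_cone1 u.
Let ex2 := hexact_cone2 u.
Let ex3 := hexact_cone3 u.

Lemma homology_factors_free_cone :
  homology_factors_free A -> homology_factors_free B ->
  homology_factors_free (cone u).
Proof.
move=> FA FB; have FsA := proj2 (homology_factors_free_susp A) FA.
have FsB := proj2 (homology_factors_free_susp B) FB.
exact: (homology_factors_free_five ex1 ex2 ex3 FA FB FsA FsB).
Qed.

Lemma fgp_homology_cone3 : fgp_homology A -> fgp_homology B -> fgp_homology (cone u).
Proof.
move=> [FA KA] [FB KB]; split; first exact: homology_factors_free_cone.
exact: (homology_killed_mid ex2 KB (proj2 (homology_killed_susp A) KA)).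
Qed.

(** Rotating the triangle puts susp B in the middle of a five-term exact sequence
    of complexes; working with the suspension avoids desuspending the cone. *)
Lemma fgp_homology_cone2 : fgp_homology A -> fgp_homology (cone u) -> fgp_homology B.
Proof.
move=> /fgp_homology_susp gsA gC; apply/fgp_homology_susp.
have [FsA KsA] := gsA; have [FC KC] := gC.
have [FsC KsC] := proj2 (fgp_homology_susp _) gC.
have [FssA _] := proj2 (fgp_homology_susp _) gsA.
split; last exact: (homology_killed_mid (hexact_susp ex1) KsA KsC).
exact: (homology_factors_free_five ex3 (hexact_susp ex1) (hexact_susp ex2) FC FsA FsC FssA).
Qed.

Lemma fgp_homology_cone1 : fgp_homology B -> fgp_homology (cone u) -> fgp_homology A.
Proof.
move=> gB gC; apply/fgp_homology_susp.
have [FB KB] := gB; have [FC KC] := gC.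
have [FsB KsB] := proj2 (fgp_homology_susp _) gB.
have [FsC _] := proj2 (fgp_homology_susp _) gC.
split; last exact: (homology_killed_mid ex3 KC KsB).
exact: (homology_factors_free_five ex2 ex3 (hexact_susp ex1) FB FC FsB FsC).
Qed.

End TwoOfThree.

Lemma fgp_homology_thick K X : fgp_homology K -> thick K X -> fgp_homology X.
Proof.
move=> gK; elim=> {X} //.
- by move=> X _ /fgp_homology_susp.
- by move=> X _ /fgp_homology_susp.
- by move=> X Y i r ri _; apply: fgp_homology_retract ri.
- move=> A B C g h k [A0 [B0 [u [a [b [c [[da db dc] _]]]]]]] _ gB _ gC.
  apply/(fgp_homology_diso da)/(@fgp_homology_cone1 _ _ u); first exact/(fgp_homology_diso db).
  exact/(fgp_homology_diso dc).
- move=> A B C g h k [A0 [B0 [u [a [b [c [[da db dc] _]]]]]]] _ gA _ gC.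
  apply/(fgp_homology_diso db)/(@fgp_homology_cone2 _ _ u); first exact/(fgp_homology_diso da).
  exact/(fgp_homology_diso dc).
- move=> A B C g h k [A0 [B0 [u [a [b [c [[da db dc] _]]]]]]] _ gA _ gB.
  apply/(fgp_homology_diso dc)/(@fgp_homology_cone3 _ _ u); first exact/(fgp_homology_diso da).
  exact/(fgp_homology_diso db).
Qed.

(** The homology of the sphere is free, and the property passes to cones. *)
Lemma homology_factors_free_kos ys : homology_factors_free (kos ys (sphere R 0)).
Proof.
elim: ys => [|y ys IH]; last exact: homology_factors_free_cone.
move=> n; have dS (z : sphere R 0 n) : diff (sphere R 0) n z = 0 by [].
have [||i iP] := @homology_map _ (sphere R 0) n 'rV[R]_(n == 0) id.
- by [].
- elim/prevz_ind: n {dS} => n z dz /(hclass_eq0 dz)[w <-]; rewrite //.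
have p_lin : linear (fun z => hclass (z : sphere R 0 n)).
  by move=> a u v; apply: hclass_linear_cycle.
apply: (@factors_free_retract _ _ _ _ i (linmap p_lin)); last exact: factors_free_rV.
by move=> h; have [z dz <-] := hclassP h; rewrite iP.
Qed.

Lemma homology_killed_kos ys : e \in ideal ys -> homology_killed (kos ys (sphere R 0)).
Proof.
move=> eI; elim/prevz_ind => n h; have [z dz <-] := hclassP h.
have dez : cycle (e *: z) by rewrite /cycle linearZ /= dz scaler0.
rewrite -hclassZ //; apply/(hclass_eq0 dez).
exact: kos_ideal_boundary.
Qed.

Lemma projective_homology X n : fgp_homology X -> projective (homology X n).
Proof.
move=> [FX KX] U V g h gh; have [m [s [r sr]]] := FX n.
have sK z : s (r z) = z by rewrite sr /f scalerBl scale1r KX subr0.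
have [k kP] : exists k : {linear 'rV[R]_m -> U}, forall v, g (k v) = (h \o s)%FUN v.
  by apply: projective_rV => v; apply: gh.
by exists (k \o r)%FUN => z /=; rewrite kP /= sK.
Qed.

Program Definition homology_complex X : complex R :=
  @Complex R (fun n => homology X n : lmodType R) (fun n => \0) _.

(** Projectivity of the homology splits the projection from cycles to classes, and
    the splitting is a quasi-isomorphism from the homology of X to X. *)
Lemma homology_complex_model X : fgp_homology X ->
  exists s : chain_map (homology_complex X) X, quasi_iso s.
Proof.
move=> gX.
have H n : exists s : {linear homology X n -> cycles X n}, forall h, \pi_(homology X n) (s h) = h.
  have [h hP] := @projective_homology X n gX (cycles X n) (homology X n)
    (linmap (@hclass_linear _ X n)) idfun (fun h => ex_intro _ (repr h) (reprK h)).
  by exists h.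
pose s n : {linear homology X n -> X n} := (val \o sval (boolp.cid (H n)))%FUN.
have sd n h : diff X n (s n h) = 0.
  by apply/is_cycleP; rewrite /s /=; apply: valP.
have sh n h : hclass (s n h) = h.
  by rewrite /s /= hclass_cycle; case: boolp.cid => ? /= ->.
have s_chain n h : s (prevz n) (diff (homology_complex X) n h) = diff X n (s n h).
  by rewrite sd raddf0.
exists (@ChainMap R (homology_complex X) X s s_chain) => n; split.
  move=> z _ /= bz; exists 0; rewrite /= -[RHS]sh; apply: esym.
  by apply/(hclass_eq0 (sd (prevz n) z)); apply: bz.
move=> w cw; exists (hclass w); first by [].
by apply/(hclass_eq cw (sd (prevz n) (hclass w))); rewrite sh.
Qed.

Lemma rowsum_const m : rowsum (const_mx 1 : 'rV[R]_m) = m%:R.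
Proof.
by rewrite /rowsum (eq_bigr (fun=> 1)) ?sumr_const ?card_ord // => i _; rewrite mxE.
Qed.

(** X is isomorphic to its homology P, a graded projective complex.  On P the
    morphism g is represented by a chain map, which sends every element to a
    boundary because P is tested by maps from spheres; so it is null by
    projectivity. *)
Lemma fgp_homology_GH X Y (g : dmap X Y) : fgp_homology X -> pi_eq0 g -> deq g (dzero X Y).
Proof.
move=> gX g0; have [s qs] := homology_complex_model gX.
set P := homology_complex X in s qs.
have gP : graded_projective P by split=> // n; apply: projective_homology.
have KP := Kprojective_graded gP.
have [c gc] := Kprojective_dmap (dcomp g (dmap_of s)) KP.
have c0 : deq (dmap_of c) (dzero P Y).
  apply/deq_dzero/nullhomotopic_boundaries => // n x.
  (* The map from a sphere that picks the element x of P. *)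
  pose a m (v : sphere R (prevz n) m) : P m := ccast P (prevz n) m (rowsum v *: x).
  have a_lin m : linear (@a m).
    by move=> b u v; rewrite /a rowsum_linear scalerDl -scalerA linearP.
  have a_chain m v : a (prevz m) (diff (sphere R (prevz n)) m v) = diff P m (a m v).
    by rewrite /a /= rowsum0 scale0r raddf0.
  pose a' := @ChainMap R (sphere R (prevz n)) P (fun m => linmap (@a_lin m)) a_chain.
  have ca0 : deq (dmap_of (ccomp c a')) (dzero _ _).
    apply: deq_trans (deq_of_comp _ _) _.
    apply: deq_trans (deq_compr _ (deq_sym gc)) _.
    apply: deq_trans (deq_sym (deq_assoc _ _ _)) _.
    exact: g0.
  have gS := graded_projective_sphere R (prevz n).
  have caN := dzero_nullhomotopic (Kprojective_graded gS)
    (Kprojective_graded (graded_projective_susp gS)) ca0.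
  have := nullhomotopic_boundary (proj1 gS) caN (n := n) (const_mx 1).
  by rewrite /= /a ccastE rowsum_const eqxx scale1r.
have gs : deq g (dcomp (dcomp g (dmap_of s)) (dmap_inv qs)).
  apply: deq_trans (deq_assoc _ _ _); apply: deq_trans (deq_sym (deq_idr _)) _.
  exact/deq_compl/deq_sym/deq_invr.
apply: deq_trans gs _; apply: deq_trans (deq_compr _ (deq_trans gc c0)) _.
have z0 : deq (dzero P Y) (dcomp (dzero X Y) (dmap_of s)).
  by apply: deq_trans (deq_of_comp _ _); apply: deq_of.
apply: deq_trans (deq_compr _ z0) _; apply: deq_trans (deq_sym (deq_assoc _ _ _)) _.
exact: deq_trans (deq_compl _ (deq_invr _)) (deq_idr _).
Qed.

Lemma fgp_homology_kos ys : e \in ideal ys -> fgp_homology (kos ys (sphere R 0)).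
Proof. by move=> eI; split; [apply: homology_factors_free_kos|apply: homology_killed_kos]. Qed.

Lemma GH_thick_fgp_homology K : fgp_homology K -> GH (thick K).
Proof. by move=> gK X Y g tX _; apply: fgp_homology_GH; apply: fgp_homology_thick tX. Qed.

End Backward.

(** Regularity of R / eR, read in R as an identity in the complementary corner
    (1 - e) R, which is the form that linear algebra uses. *)
Lemma von_neumann_regular_lift (R : comPzRingType) (xs : seq R) (e : R) :
  e * e = e -> (forall a, a \in ideal xs -> exists r, a = e * r) ->
  von_neumann_regular (ideal_quot xs) ->
  forall x : R, exists y, (1 - e) * (x * y * x) = (1 - e) * x.
Proof.
move=> ee eI vnr x; have [w wP] := vnr (\pi_(ideal_quot xs) x).
exists (repr w); apply/eqP; rewrite -subr_eq0 -mulrBr; apply/eqP.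
have [|r ->] := eI (x * repr w * x - x); last by rewrite mulrA mulrBl mul1r ee subrr mul0r.
by rewrite Quotient.idealrBE !pi_iquot_mul reprK; apply/eqP.
Qed.

Theorem corollary4p10 (R : comPzRingType) (xs : seq R) (K : complex R)
    (hK : is_koszul xs K) :
  GH (thick K) <->
  ring_summand (ideal xs) /\ von_neumann_regular (ideal_quot xs).
Proof.
have dK := diso_koszul hK; split.
  move=> gh; have tK : thick K (kos xs (sphere R 0)).
    by apply: thick_diso (diso_sym dK) _; apply: thick_gen.
  by split; [apply: GH_ring_summand gh _ tK|apply: GH_von_neumann_regular gh _ tK].
move=> [[e ee eI] /(von_neumann_regular_lift ee (fun a => proj1 (eI a))) vnr].
apply: (GH_thick_fgp_homology ee vnr); have [d dd] := dK.
apply/(fgp_homology_diso e dd)/fgp_homology_kos => //.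
by apply/eI; exists e.
Qed.
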